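(* Let $\mathcal{H}_u$ be a separable Hilbert space, $\mu_0=\mathcal{N}(0,\mathcal{C}_0)$ a Gaussian measure on $\mathcal{H}_u$ with Cameron–Martin space $\mathcal{H}$, $T>0$, and $\Theta$ a parameter set. Let $f_\theta:\mathcal{H}_u\to\mathcal{H}_u$ be the flow map $f_\theta(u)=v(T)$ of the ODE $$\frac{dv(t)}{dt}=h(v(t),t;\theta),\qquad v(0)=u,$$ and let $\mu_{f_\theta}={f_\theta}_{\#}\mu_0$ (the f-CNF prior). Consider the Bayesian inverse problem with prior $\mu_{f_\theta}$, data $\bm{d}\in Y=\mathbb{R}^{N_d}$ and likelihood $\mathbb{L}(\bm{d}|u)$, whose posterior $\mu_{\bm{d}}$ is given by $$\frac{d\mu_{\bm{d}}}{d\mu_{f_\theta}}(u)=\frac{1}{Z}\,\mathbb{L}(\bm{d}|u),\qquad Z=\int_{\mathcal{H}_u}\mathbb{L}(\bm{d}|u)\,\mu_{f_\theta}(du).$$ Assume: 1. $h(\cdot,\cdot;\theta)\in\mathcal{T}(\mu_0,[0,T],\mathcal{H})$ for all $\theta\in\Theta$; 2. the likelihood $\mathbb{L}(\cdot|u)$ is continuous; 3. there exists a constant $M$ independent of $u$ and $\bm{d}$ with $0<\mathbb{L}(\bm{d}|u)\le M$. Then the Bayesian inverse problem is weakly, Hellinger, total variation, and Wasserstein($p$) well-posed.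
   Context: Pushforward: $(f_{\#}\mu_0)(B)=\mu_0(f^{-1}(B))$ for Borel $B$. The likelihood is a function $\mathbb{L}(\bm{d}|u)=\exp(-\Phi(\bm{d}|u))$, measurable in $u$. The ODE is taken to be well-posed, i.e. for each $\theta$ and each initial (or terminal) value it has a unique solution on $[0,T]$. $D$ is the Fréchet derivative in the state variable; $\|\cdot\|_1=\mathrm{tr}(|\cdot|)$ is the trace norm. The class $\mathcal{HC}^1(\mu_0,\mathcal{H})$ consists of all $\mu_0$-measurable mappings $\mathcal{F}:\mathcal{H}_u\to\mathcal{H}$ such that for almost every $u\in\mathcal{H}_u$ the mapping $k\mapsto\mathcal{F}(u+k)$ is Fréchet differentiable along $\mathcal{H}$, its derivative is a Hilbert–Schmidt operator, and $k\mapsto D\mathcal{F}(u+k)$ from $\mathcal{H}$ to the space of Hilbert–Schmidt operators on $\mathcal{H}$ is continuous. The class $\mathcal{T}(\mu_0,[0,T],\mathcal{H})$ consists of all functions $h:\mathcal{H}_u\times[0,T]\to\mathcal{H}_u$ such that, with constants $M_1,M_2,L$ independent of $u$ and $t$: (i) for each $t\in[0,T]$, $h(\cdot,t)\in\mathcal{HC}^1(\mu_0,\mathcal{H})$; (ii) $\sup_{t\in[0,T],\,u\in\mathcal{H}_u}\|\mathcal{C}_0^{-1}h(u,t)\|_{\mathcal{H}_u}\le M_1<\infty$; (iii) $\sup_{t\in[0,T],\,u\in\mathcal{H}_u}\|Dh(u,t)\|_1\le M_2<\infty$; (iv) for each $t\in[0,T]$, $\|h(u_1,t)-h(u_2,t)\|_{\mathcal{H}_u}\le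 L\|u_1-u_2\|_{\mathcal{H}_u}$ for all $u_1,u_2\in\mathcal{H}_u$. Well-posedness: let $\mathbb{P}$ be the set of all probability measures on $\mathcal{H}_u$ and $\rho$ a metric on it. The Bayesian inverse problem is $\rho$-well-posed if (existence and uniqueness) for each $\bm{d}$ Bayes' formula has a unique posterior $\mu_{\bm{d}}\in\mathbb{P}$, and (stability) the map $(Y,\|\cdot\|_Y)\ni\bm{d}\mapsto\mu_{\bm{d}}\in(\mathbb{P},\rho)$ is continuous. It is weakly, total variation, Hellinger, or Wasserstein($p$) well-posed if it is $\rho$-well-posed with $\rho$ the Prokhorov metric, the total variation distance, the Hellinger distance, or the Wasserstein($p$) distance ($p\in[1,\infty)$), respectively; in the Wasserstein($p$) case $\mathbb{P}$ is understood as the set of probability measures on $\mathcal{H}_u$ with finite $p$-th moment. *)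

(* Defs.v *)
From HB Require Import structures.
From mathcomp Require Import all_boot all_order all_algebra.
From mathcomp Require Import all_classical all_reals all_analysis.

Set Implicit Arguments.
Unset Strict Implicit.
Unset Printing Implicit Defensive.

Import Order.TTheory GRing.Theory Num.Theory.
Import numFieldNormedType.Exports.

Local Open Scope classical_set_scope.
Local Open Scope ring_scope.

HB.mixin Record CompleteNormedModule_isHilbert (R : realType) V
    & CompleteNormedModule R V := {
  dot : V -> V -> R ;
  dotC : forall x y, dot x y = dot y x ;
  dotDl : forall x y z, dot (x + y) z = dot x z + dot y z ;
  dotZl : forall (a : R) x y, dot (a *: x) y = a * dot x y ;
  dot_norm : forall x, dot x x = `|x| ^+ 2
}.

#[short(type="hilbertType")]
HB.structure Definition Hilbert (R : realType) :=
  {V of CompleteNormedModule_isHilbert R V & CompleteNormedModule R V}.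

Definition separable (V : topologicalType) : Prop :=
  exists2 D : set V, countable D & dense D.

(* The space V with its Borel sigma-algebra; convertible to V. *)
Notation borel V := (g_sigma_algebraType (@open V)).

Section Operators.
Context (R : realType) (V : hilbertType R).
Implicit Types (A P C S : {linear V -> V}) (B : set V).

(* Orthonormal families that are complete (maximal). *)
Definition is_onb B : Prop :=
  [/\ forall e, B e -> `|e| = 1,
      forall e e', B e -> B e' -> e <> e' -> dot e e' = 0
    & forall x, (forall e, B e -> dot x e = 0) -> x = 0].

Definition is_positive_op P : Prop :=
  [/\ continuous P,
      forall x y, dot (P x) y = dot x (P y)
    & forall x, 0 <= dot (P x) x].

(* P = (A^* A)^(1/2), the identity P^2 = A^* A being tested against y. *)
Definition is_abs_op A P : Prop :=
  is_positive_op P /\ forall x y, dot (P (P x)) y = dot (A x) (A y).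

Definition is_sqrt_op C S : Prop :=
  is_positive_op S /\ forall x, S (S x) = C x.

(* In the next three definitions the set has exactly one element, by uniqueness
   of |A| and independence of the orthonormal basis; [xget] names it. *)
Definition trace P : \bar R :=
  xget +oo%E [set t | exists2 B, is_onb B &
                        t = (\esum_(e in B) (dot (P e) e)%:E)%E].

Definition trace_norm A : \bar R :=
  xget +oo%E [set t | exists2 P, is_abs_op A P & t = trace P].

Definition hs_norm (A : V -> V) : \bar R :=
  poweR (xget +oo%E [set t | exists2 B, is_onb B &
                        t = (\esum_(e in B) (`|A e| ^+ 2)%:E)%E]) 2^-1.

(* w = C^-1 x. When C is not injective this is the usual convention: the
   preimage of x orthogonal to the kernel of C. *)
Definition is_preimage_op C (x w : V) : Prop :=
  C w = x /\ forall z, C z = 0 -> dot w z = 0.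

End Operators.

Section Gaussian.
Context (R : realType) (V H : hilbertType R).

(* N(0, v) on the real line; [normal_prob] takes a standard deviation and is
   not a Dirac mass at standard deviation 0. *)
Definition centered_normal (v : R) : set R -> \bar R :=
  if v == 0 then \d_(0 : R) else normal_prob 0 (Num.sqrt v).

Definition is_centered_gaussian (C0 : {linear V -> V})
    (mu0 : probability (borel V) R) : Prop :=
  [/\ is_positive_op C0, (trace C0 < +oo)%E &
      forall (y : V) (A : set R), measurable A ->
        mu0 [set u | A (dot (u : V) y)] = centered_normal (dot (C0 y) y) A].

(* iota identifies H with the range of C0^(1/2), normed by |C0^(-1/2) k|. *)
Definition is_cameron_martin (C0 : {linear V -> V}) (iota : {linear H -> V})
    : Prop :=
  exists2 S, is_sqrt_op C0 S &
    (forall x, exists k, iota k = S x) /\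
    (forall k, exists2 x, is_preimage_op S (iota k) x & `|k| = `|x|).

(* Measurability with respect to the mu0-completion of the Borel sets. *)
Definition completion_measurable (mu0 : probability (borel V) R) (F : V -> H)
    : Prop :=
  forall B : set (borel H), measurable B ->
    exists2 A : set (borel V), measurable A &
      mu0.-negligible ((F @^-1` B `\` A) `|` (A `\` F @^-1` B)).

Definition translate (iota : {linear H -> V}) (F : V -> H) (u : V) : H -> H :=
  fun k => F (u + iota k).

Definition HC1 (mu0 : probability (borel V) R) (iota : {linear H -> V})
    (F : V -> H) : Prop :=
  completion_measurable mu0 F /\
  {ae mu0, forall u : V,
    let G := translate iota F u in
    [/\ forall k, differentiable G k,
        forall k, (hs_norm ('d G k) < +oo)%E
      & forall k, hs_norm (fun x => 'd G k' x - 'd G k x) @[k' --> k]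
                    --> 0%E]}.

(* F is h read as a map into H. In the trace-norm bound, Dh(u,t) is the
   derivative along H, an operator on H; the bound is imposed at every u where
   this derivative exists. *)
Definition class_T (mu0 : probability (borel V) R) (C0 : {linear V -> V})
    (iota : {linear H -> V}) (T : R) (h : V -> R -> V) : Prop :=
  exists (F : V -> R -> H) (M1 M2 L : R),
  forall t, 0 <= t <= T ->
  [/\ (forall u, iota (F u t) = h u t) /\ HC1 mu0 iota (F ^~ t),
      forall u, exists2 w, is_preimage_op C0 (h u t) w & `|w| <= M1,
      forall u, let G := translate iota (F ^~ t) u in let k0 : H := 0 in
        differentiable G k0 -> (trace_norm ('d G k0) <= M2%:E)%E
    & forall u1 u2, `|h u1 t - h u2 t| <= L * `|u1 - u2|].

End Gaussian.

Section Flow.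
Context (R : realType) (V : hilbertType R).
Implicit Types (T : R) (h : V -> R -> V) (v : R -> V).

(* dv/dt = h(v(t), t) on [0, T], one-sided at the endpoints; the values of v
   outside [0, T] are irrelevant. *)
Definition is_solution T h v : Prop :=
  forall t, 0 <= t <= T ->
    (s - t)^-1 *: (v s - v t) @[s --> within [set s | 0 <= s <= T] t^']
      --> h (v t) t.

Definition ode_well_posed_at T h (t0 : R) : Prop :=
  forall x, exists v, [/\ is_solution T h v, v t0 = x &
    forall w, is_solution T h w -> w t0 = x ->
      forall t, 0 <= t <= T -> w t = v t].

Definition ode_well_posed T h : Prop :=
  ode_well_posed_at T h 0 /\ ode_well_posed_at T h T.

Definition flow_map T h (u : V) : V :=
  xget 0 [set v T | v in [set v | is_solution T h v /\ v 0 = u]].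

End Flow.

Section Distances.
Context (R : realType) (V : hilbertType R).
Local Notation prob := (probability (borel V) R).
Implicit Types (mu nu : prob).
Local Open Scope ereal_scope.

Definition enlargement (e : R) (B : set V) : set V :=
  [set x | exists2 y, B y & (`|x - y| < e)%R].

Definition prokhorov_dist mu nu : \bar R :=
  ereal_inf [set e%:E | e in [set e : R | (0 < e)%R /\
    forall B : set (borel V), measurable B ->
      mu B <= nu (enlargement e B) + e%:E /\
      nu B <= mu (enlargement e B) + e%:E]].

Definition tv_dist mu nu : \bar R :=
  ereal_sup [set `|mu B - nu B| | B in [set B : set (borel V) | measurable B]].

Definition is_density (la : {measure set (borel V) -> \bar R})
    (f : borel V -> R) mu : Prop :=
  [/\ measurable_fun [set: borel V] f, forall x, (0 <= f x)%R &
      forall B, measurable B -> mu B = \int[la]_(x in B) (f x)%:E].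

(* The set has exactly one element: the value does not depend on the
   dominating measure la. *)
Definition hellinger_dist mu nu : \bar R :=
  xget +oo [set t | exists (la : {sigma_finite_measure set (borel V) -> \bar R})
    (f g : borel V -> R), [/\ is_density la f mu, is_density la g nu &
      t = poweR ((2^-1)%:E *
        \int[la]_x ((Num.sqrt (f x) - Num.sqrt (g x)) ^+ 2)%:E) 2^-1]].

Definition is_coupling (pi : probability (borel V * borel V)%type R) mu nu
    : Prop :=
  forall B : set (borel V), measurable B ->
    pi (B `*` setT) = mu B /\ pi (setT `*` B) = nu B.

Definition wasserstein_dist (p : R) mu nu : \bar R :=
  poweR (ereal_inf
    [set \int[pi]_z (`|(z.1 : V) - (z.2 : V)|%R `^ p)%:E
      | pi in [set pi | is_coupling pi mu nu]]) p^-1.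

Definition finite_moment (p : R) : set prob :=
  [set mu : prob | \int[mu]_u (`|u : V|%R `^ p)%:E < +oo].

End Distances.

Section BayesianInverseProblem.
Context (R : realType) (V : hilbertType R) (Y : normedModType R).
Local Notation prob := (probability (borel V) R).
Implicit Types (prior : set (borel V) -> \bar R) (L : Y -> V -> R).

Definition likelihood (Phi : Y -> V -> R) : Y -> V -> R :=
  fun d u => expR (- Phi d u).

Definition evidence prior L (d : Y) : \bar R :=
  (\int[prior]_u (L d u)%:E)%E.

(* Bayes' formula is meaningful only when 0 < Z < +oo. *)
Definition is_posterior prior L (d : Y) (mu : prob) : Prop :=
  (0 < evidence prior L d < +oo)%E /\
  forall B : set (borel V), measurable B ->
    mu B = (\int[prior]_(u in B) ((fine (evidence prior L d))^-1 * L d u)%:E)%E.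

(* Equality of measures is equality on measurable sets. *)
Definition well_posed (PP : set prob) (rho : prob -> prob -> \bar R) prior L
    : Prop :=
  exists post : Y -> prob,
    (forall d, [/\ PP (post d), is_posterior prior L d (post d) &
       forall nu, PP nu -> is_posterior prior L d nu ->
         forall B : set (borel V), measurable B -> nu B = post d B]) /\
    (forall d, rho (post d') (post d) @[d' --> d] --> 0%E).

Definition weakly_well_posed := well_posed setT (@prokhorov_dist R V).
Definition tv_well_posed := well_posed setT (@tv_dist R V).
Definition hellinger_well_posed := well_posed setT (@hellinger_dist R V).
Definition wasserstein_well_posed (p : R) :=
  well_posed (finite_moment p) (@wasserstein_dist R V p).

End BayesianInverseProblem.

(* Main.v *)
Require Import Defs.
From HB Require Import structures.
From mathcomp Require Import all_boot all_order all_algebra.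
From mathcomp Require Import all_classical all_reals all_analysis.
From mathcomp Require Import measurable_realfun.
From mathcomp Require Import ring lra.

Set Implicit Arguments.
Unset Strict Implicit.
Unset Printing Implicit Defensive.

Import Order.TTheory GRing.Theory Num.Theory.
Import numFieldNormedType.Exports.

Local Open Scope classical_set_scope.
Local Open Scope ring_scope.

(** The statement splits into a fact about the prior and a fact about Bayes'
    formula.

    The prior. The velocity field h takes its values in the image under the
    continuous operator C0 of a ball, so it is bounded by some K, and the flow
    map f moves no point by more than K * T ([flow_map_dist_le]). As h is
    Lipschitz in the state, Gronwall's inequality makes f Lipschitz, hence
    Borel measurable ([flow_map_continuous]). The prior is therefore a
    probability measure, and it has moments of all orders because mu0
    integrates expR (c * |u| ^+ 2) for some c > 0 ([fernique],
    [pushforward_moment_fin]). For the latter, Parseval's identity in an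
    orthonormal basis in which the covariance has finite trace and Jensen's
    inequality reduce the exponential moment to the one-dimensional marginals
    [gaussian_marginal_expo].

    Bayes' formula. The evidence lies in the interval from 0 (excluded) to M,
    so the posterior exists and is unique, with a bounded density. The
    likelihood is continuous in the data and bounded, so dominated convergence
    gives continuity of the evidence and then of the density in L1(prior) with
    any integrable weight phi ([posterior_density_cvg]). The weight phi = 1
    controls the total variation distance, which dominates the Prokhorov
    distance ([prokhorov_le_tv]) and the square of the Hellinger distance
    ([hellinger_dist_le]); the weight phi = |u| `^ p controls the p-th power of
    the Wasserstein distance, through a coupling that leaves the common part of
    the two posteriors in place ([wasserstein_dist_le]). *)

(** * Inner product and one-sided derivatives *)

Section InnerProduct.
Context (R : realType) (V : hilbertType R).
Implicit Types (x y z : V).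

Lemma dotDr x y z : dot x (y + z) = dot x y + dot x z.
Proof. by rewrite dotC dotDl !(dotC x). Qed.

Lemma dotZr (a : R) x y : dot x (a *: y) = a * dot x y.
Proof. by rewrite dotC dotZl dotC. Qed.

Lemma dot0l x : dot 0 x = 0 :> R.
Proof. by rewrite -(scale0r (0 : V)) dotZl mul0r. Qed.

Lemma dot0r x : dot x 0 = 0 :> R.
Proof. by rewrite dotC dot0l. Qed.

Lemma dotNl x y : dot (- x) y = - dot x y.
Proof. by rewrite -scaleN1r dotZl mulN1r. Qed.

Lemma dotNr x y : dot x (- y) = - dot x y.
Proof. by rewrite dotC dotNl dotC. Qed.

Lemma dotBl x y z : dot (x - y) z = dot x z - dot y z.
Proof. by rewrite dotDl dotNl. Qed.

Lemma dotBr x y z : dot x (y - z) = dot x y - dot x z.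
Proof. by rewrite dotDr dotNr. Qed.

Lemma dot_suml (n : nat) (f : 'I_n -> V) y :
  dot (\sum_(i < n) f i) y = \sum_(i < n) dot (f i) y.
Proof.
elim: n f => [|n IHn] f; first by rewrite !big_ord0 dot0l.
by rewrite !big_ord_recl dotDl IHn.
Qed.

Lemma cauchy_schwarz x y : `|dot x y| <= `|x| * `|y|.
Proof.
have [->|y0] := eqVneq y 0; first by rewrite dot0r !normr0 mulr0.
have y2 : 0 < `|y| ^+ 2 by rewrite exprn_gt0 ?normr_gt0.
have := sqr_ge0 `|(`|y| ^+ 2) *: x - dot x y *: y|.
rewrite -dot_norm dotBl !dotBr !dotZl !dotZr !dot_norm (dotC y x) => h.
have {}h : 0 <= `|y| ^+ 2 * (`|x| ^+ 2 * `|y| ^+ 2 - dot x y ^+ 2) by nra.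
rewrite pmulr_rge0// subr_ge0 in h.
by rewrite -(@ler_pXn2r _ 2)// ?nnegrE ?mulr_ge0// exprMn real_normK// num_real.
Qed.

Lemma cvg_dot (U : Type) (F : set_system U) (FF : Filter F) (f g : U -> V) a b :
  f @ F --> a -> g @ F --> b -> dot (f x) (g x) @[x --> F] --> (dot a b : R).
Proof.
move=> fa gb.
apply/subr_cvg0.
have h : `|f x - a| * `|g x| + `|a| * `|g x - b| @[x --> F] --> (0 : R).
  have -> : (0 : R) = 0 * `|b| + `|a| * 0 by rewrite mul0r mulr0 addr0.
  apply: cvgD; apply: cvgM.
  - by apply/norm_cvg0P/subr_cvg0.
  - exact: cvg_norm.
  - exact: cvg_cst.
  - by apply/norm_cvg0P/subr_cvg0.
apply/norm_cvg0P; apply: (squeeze_cvgr _ (cvg_cst 0) h).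
near=> x; rewrite normr_ge0/=.
have -> : dot (f x) (g x) - dot a b = dot (f x - a) (g x) + dot a (g x - b).
  by rewrite dotBl dotBr; ring.
by rewrite (le_trans (ler_normD _ _))// lerD// cauchy_schwarz.
Unshelve. all: by end_near. Qed.

End InnerProduct.

Section OneSidedDerivative.
Context (R : realType) (T : R).

(** The difference quotients of f at t, taken within [0, T], converge to f'.
    A solution of the ODE is a curve v with derivative h (v t) t in this sense;
    the derivative is one-sided at the endpoints. *)
Definition derives_on (W : normedModType R) (f : R -> W) (t : R) (f' : W) :=
  (s - t)^-1 *: (f s - f t) @[s --> within [set s | 0 <= s <= T] t^'] --> f'.

Lemma derives_on_cvg (W : normedModType R) (f : R -> W) t f' :
  derives_on f t f' -> f s @[s --> within [set s | 0 <= s <= T] t^'] --> f t.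
Proof.
move=> df; apply/subr_cvg0.
have h : (s - t) *: ((s - t)^-1 *: (f s - f t))
    @[s --> within [set s | 0 <= s <= T] t^'] --> (0 : W).
  rewrite -(scale0r f'); apply: cvgZ df.
  apply: cvg_within_filter; apply/subr_cvg0; exact: nbhs_dnbhs.
apply: cvg_trans h; apply: near_eq_cvg.
apply: (@cvg_within _ _ _ _ _).
near=> s; rewrite scalerA mulfV ?scale1r// subr_eq0.
by near: s; exact: nbhs_dnbhs_neq.
Unshelve. all: by end_near. Qed.

Lemma derives_on_dot (V : hilbertType R) (f g : R -> V) t f' g' :
  derives_on f t f' -> derives_on g t g' ->
  derives_on (fun s => dot (f s) (g s) : R^o) t (dot f' (g t) + dot (f t) g').
Proof.
move=> df dg; rewrite /derives_on.
have h : dot ((s - t)^-1 *: (f s - f t)) (g s) +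
    dot (f t) ((s - t)^-1 *: (g s - g t))
    @[s --> within [set s | 0 <= s <= T] t^'] -->
    (dot f' (g t) + dot (f t) g').
  apply: cvgD; apply: cvg_dot => //; last exact: cvg_cst.
  exact: derives_on_cvg dg.
apply: cvg_trans h; apply: near_eq_cvg; near=> s.
rewrite dotZl dotZr dotBl dotBr -mulrDr; congr (_ * _).
by rewrite addrA subrK.
Unshelve. all: by end_near. Qed.

Lemma derives_on_cst (W : normedModType R) (x : W) t :
  derives_on (fun=> x) t 0.
Proof.
rewrite /derives_on; under eq_fun do rewrite subrr scaler0.
exact: cvg_cst.
Qed.

Lemma derives_onB (W : normedModType R) (f g : R -> W) t f' g' :
  derives_on f t f' -> derives_on g t g' ->
  derives_on (fun s => f s - g s) t (f' - g').
Proof.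
move=> df dg; rewrite /derives_on.
have h : (s - t)^-1 *: (f s - f t) - (s - t)^-1 *: (g s - g t)
    @[s --> within [set s | 0 <= s <= T] t^'] --> f' - g' by exact: cvgB.
apply: cvg_trans h; apply: near_eq_cvg; near=> s.
by rewrite -scalerBr !opprD !opprK addrACA.
Unshelve. all: by end_near. Qed.

Lemma derives_onZ (W : normedModType R) (a : R -> R^o) (f : R -> W) t a' f' :
  derives_on a t a' -> derives_on f t f' ->
  derives_on (fun s => a s *: f s) t (a' *: f t + a t *: f').
Proof.
move=> da df; rewrite /derives_on.
have h : ((s - t)^-1 *: (a s - a t)) *: f s +
    a t *: ((s - t)^-1 *: (f s - f t))
    @[s --> within [set s | 0 <= s <= T] t^'] -->
    (a' *: f t + a t *: f').
  apply: cvgD; apply: cvgZ => //; last exact: cvg_cst.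
  exact: derives_on_cvg df.
apply: cvg_trans h; apply: near_eq_cvg; near=> s.
rewrite -scalerA [a t *: _]scalerA mulrC -scalerA -scalerDr scalerBl scalerBr.
by rewrite addrA subrK.
Unshelve. all: by end_near. Qed.

Lemma dnbhs_shift0 (t : R) : (s - t) @[s --> t^'] = (0 : R)^'.
Proof.
rewrite predeqE => A.
change ((\forall s \near t, s != t -> A (s - t)) <->
  (\forall s \near (0 : R), s != 0 -> A s)).
rewrite (near_shift 0 t)/= subr0.
have E s : (s + t != t) = (s != 0) by rewrite -subr_eq0 addrK.
by split; apply: filterS => s /=; rewrite addrK E.
Qed.

Lemma derives_on_derive (f : R -> R^o) (t : R) (f' : R^o) :
  is_derive t 1 f f' -> derives_on f t f'.
Proof.
move=> [df <-]; rewrite /derives_on.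
apply: cvg_within_filter.
move: df; rewrite /derivable/derive -(dnbhs_shift0 t) => df.
apply: cvg_trans df; apply: near_eq_cvg; near=> s.
by rewrite /= [_%:A]mulr1 subrK.
Unshelve. all: by end_near. Qed.

Lemma within_dnbhs_interior (t : R) : 0 < t < T ->
  within [set s | 0 <= s <= T] t^' = t^'.
Proof.
move=> /andP[t0 tT]; apply/seteqP; split => A; last exact: cvg_within.
rewrite /within/= => hA.
have : \forall s \near t^', 0 <= s <= T.
  apply: nbhs_dnbhs; near=> s; apply/andP; split; apply: ltW; near: s.
    exact: lt_nbhsr.
  exact: lt_nbhsl.
by apply: filterS2 hA => s h /h.
Unshelve. all: by end_near. Qed.

Lemma derives_on_interior (f : R -> R^o) (t : R) (f' : R^o) : 0 < t < T ->
  derives_on f t f' -> is_derive t 1 f f'.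
Proof.
move=> t0T; rewrite /derives_on within_dnbhs_interior// => df.
have h : h^-1 *: ((f \o shift t) (h *: 1) - f t) @[h --> (0 : R)^'] --> f'.
  rewrite -(dnbhs_shift0 t).
  suff : (s - t)^-1 *: ((f \o shift t) ((s - t) *: 1) - f t)
    @[s --> t^'] --> f'.
    by [].
  apply: cvg_trans df; apply: near_eq_cvg; near=> s.
  by rewrite /= [_%:A]mulr1 subrK.
by split; [apply/cvg_ex; exists f'|exact: (cvg_lim (@norm_hausdorff _ _) h)].
Unshelve. all: by end_near. Qed.

(** The mean value inequality for a function differentiable on the closed
    interval in the one-sided sense. *)
Lemma mean_value_le (f : R -> R^o) (f' : R -> R^o) (C : R) : 0 < T ->
  (forall t, 0 <= t <= T -> derives_on f t (f' t)) ->
  (forall t, 0 <= t <= T -> f' t <= C) ->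
  f T - f 0 <= C * T.
Proof.
move=> T0 df fC.
have [||c] := @MVT R f f' 0 T T0.
- move=> x; rewrite in_itv/= => /andP[x0 xT].
  apply: derives_on_interior; first by rewrite x0.
  by apply: df; rewrite !ltW.
- apply/subspace_continuousP => x /=; rewrite in_itv/= => x0T.
  have h := derives_on_cvg (df _ x0T).
  move=> A fA; have := h A fA; rewrite /fmap/=.
  change ((\forall s \near x, s != x -> 0 <= s <= T -> A (f s)) ->
    \forall s \near x, s \in `[0, T] -> A (f s)).
  apply: filterS => s hs; rewrite in_itv/= => s0T.
  have [->|sx] := eqVneq s x; first exact: nbhs_singleton.
  exact: hs.
- rewrite in_itv/= subr0 => /andP[c0 cT] ->.
  by rewrite ler_pM2r// fC// !ltW.
Qed.
End OneSidedDerivative.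

(** * Estimates on the flow *)

Section FlowEstimates.
Context (R : realType) (V : hilbertType R) (T : R) (h : V -> R -> V).
Hypothesis T_gt0 : 0 < T.

(** The mean value inequality applied to the component of the solution along
    its own total displacement y. *)
Lemma solution_dist_le (K : R) (v : R -> V) :
  (forall u t, 0 <= t <= T -> `|h u t| <= K) ->
  is_solution T h v -> `|v T - v 0| <= K * T.
Proof.
move=> hK sv; set y := v T - v 0.
have [y0|y0] := eqVneq y 0.
  have : `|h 0 0| <= K by apply: hK; rewrite lexx ltW.
  rewrite y0 normr0 => /(le_trans (normr_ge0 _)) K0.
  by rewrite mulr_ge0// ltW.
have dv t : 0 <= t <= T -> derives_on T (fun s => dot (v s) y : R^o) t
    (dot (h (v t) t) y + dot (v t) 0).
  by move=> t0T; apply: derives_on_dot (sv t t0T) (derives_on_cst _ _ _).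
have := mean_value_le T_gt0 dv (C := K * `|y|).
rewrite -dotBl -/y dot_norm => /(_ _)H.
have : `|y| ^+ 2 <= K * `|y| * T.
  apply: H => t t0T; rewrite dot0r addr0.
  rewrite (le_trans (ler_norm _))// (le_trans (cauchy_schwarz _ _))//.
  by rewrite ler_wpM2r// hK.
by rewrite mulrAC expr2 ler_pM2r// normr_gt0.
Qed.

(** Gronwall's estimate: for the difference w of two solutions, the function
    expR (- 2 * L * t) * |w t| ^+ 2 is nonincreasing. *)
Lemma solutions_lipschitz (L : R) (v1 v2 : R -> V) : 0 <= L ->
  (forall t, 0 <= t <= T -> forall u1 u2,
    `|h u1 t - h u2 t| <= L * `|u1 - u2|) ->
  is_solution T h v1 -> is_solution T h v2 ->
  `|v1 T - v2 T| <= expR (L * T) * `|v1 0 - v2 0|.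
Proof.
move=> L0 hL s1 s2; pose w s := v1 s - v2 s.
pose a (s : R) : R^o := expR (- (2 * L) * s).
have da t : 0 <= t <= T -> derives_on T a t (- (2 * L) * a t).
  move=> _; apply: derives_on_derive; rewrite /a.
  have hc := @is_derive1_comp R expR ( *:%R (- (2 * L))) t _ _
    (is_derive_expR _) (is_deriveZ _ (is_derive_id _ _)).
  by apply: is_derive_eq hc _; rewrite [_%:A]mulr1 mulrC.
have dw t : 0 <= t <= T -> derives_on T w t (h (v1 t) t - h (v2 t) t).
  by move=> t0T; apply: derives_onB; [exact: s1|exact: s2].
have dphi t : 0 <= t <= T ->
    derives_on T (fun s => a s *: (dot (w s) (w s) : R^o)) t
    ((- (2 * L) * a t) *: (dot (w t) (w t) : R^o) +
     a t *: (dot (h (v1 t) t - h (v2 t) t) (w t) +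
             dot (w t) (h (v1 t) t - h (v2 t) t) : R^o)).
  move=> t0T; have dww := derives_on_dot (dw _ t0T) (dw _ t0T).
  exact: (derives_onZ (W := R^o) (da _ t0T) dww).
have /= := mean_value_le T_gt0 dphi (C := 0).
rewrite mul0r subr_le0 /a mulr0 expR0 scale1r !dot_norm => H.
have {}H : expR (- (2 * L) * T) * `|w T| ^+ 2 <= `|w 0| ^+ 2.
  apply: H => t t0T.
  have hw : dot (h (v1 t) t - h (v2 t) t) (w t) <= L * `|w t| ^+ 2.
    rewrite (le_trans (ler_norm _))// (le_trans (cauchy_schwarz _ _))//.
    by rewrite expr2 mulrA ler_wpM2r// hL.
  rewrite dot_norm (dotC (w t)) /GRing.scale/=.
  have := expR_gt0 (- (2 * L) * t).
  nra.
rewrite -(@ler_pXn2r _ 2)// ?nnegrE ?mulr_ge0 ?expR_ge0//.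
rewrite exprMn -expRM_natl -ler_pdivrMl ?expR_gt0// -expRN.
by apply: le_trans H; rewrite -/(w T) mulNr mulrA.
Qed.

Lemma flow_mapP (u : V) : ode_well_posed_at T h 0 ->
  exists2 v, is_solution T h v /\ v 0 = u & flow_map T h u = v T.
Proof.
move=> /(_ u)[v [sv v0 _]].
have : [set v T | v in [set v | is_solution T h v /\ v 0 = u]] (flow_map T h u).
  by rewrite /flow_map; apply: xgetPex; exists (v T); exists v.
by case=> x xs <-; exists x.
Qed.

Lemma flow_map_dist_le (K : R) (u : V) : ode_well_posed_at T h 0 ->
  (forall u t, 0 <= t <= T -> `|h u t| <= K) ->
  `|flow_map T h u - u| <= K * T.
Proof.
by move=> /(flow_mapP u)[v [sv <-] ->] hK; exact: solution_dist_le.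
Qed.

Lemma flow_map_continuous (L : R) : ode_well_posed_at T h 0 ->
  (forall t, 0 <= t <= T -> forall u1 u2,
    `|h u1 t - h u2 t| <= L * `|u1 - u2|) ->
  continuous (flow_map T h).
Proof.
move=> wp hL u.
have {}hL t : 0 <= t <= T -> forall u1 u2,
    `|h u1 t - h u2 t| <= `|L| * `|u1 - u2|.
  move=> t0T u1 u2; apply: le_trans (hL _ t0T _ _) _.
  by rewrite ler_wpM2r// ler_norm.
have H x : `|flow_map T h x - flow_map T h u| <= expR (`|L| * T) * `|x - u|.
  have [v [sv <-] ->] := flow_mapP x wp.
  have [v' [sv' <-] ->] := flow_mapP u wp.
  exact: solutions_lipschitz.
apply/subr_cvg0/norm_cvg0P.
have h0 : expR (`|L| * T) * `|x - u| @[x --> u] --> 0.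
  rewrite -(mulr0 (expR (`|L| * T))); apply: cvgM; first exact: cvg_cst.
  by apply/norm_cvg0P/subr_cvg0; exact: cvg_id.
apply: squeeze_cvgr (cvg_cst 0) h0.
by apply: nearW => x; rewrite normr_ge0 H.
Qed.

End FlowEstimates.

(** A velocity field of the class is bounded and Lipschitz in the state, both
    uniformly in time; the bound on h comes from h = C0 w with w bounded. *)
Lemma class_T_bounds (R : realType) (Hu H : hilbertType R)
    (C0 : {linear Hu -> Hu}) (mu0 : probability (borel Hu) R)
    (iota : {linear H -> Hu}) (T : R) (h : Hu -> R -> Hu) :
  continuous C0 -> class_T mu0 C0 iota T h ->
  exists K L : R, forall t, 0 <= t <= T ->
    (forall u, `|h u t| <= K) /\
    (forall u1 u2, `|h u1 t - h u2 t| <= L * `|u1 - u2|).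
Proof.
move=> cC0 [F [M1 [M2 [L hT]]]].
have /linear_boundedP := continuous_linear_bounded 0 (cC0 0).
move=> /pinfty_ex_gt0[k k0 hk].
exists (k * M1), L => t /hT[_ hC _ hL]; split=> // u.
have [w [<- _] wM] := hC u.
by rewrite (le_trans (hk w))// ler_wpM2l// ltW.
Qed.

(** * Borel measurability and orthonormal expansions *)

Section BorelMeasurability.
Context (R : realType) (V W : normedModType R).

Lemma continuous_borel_measurable (f : V -> W) :
  continuous f -> measurable_fun [set: borel V] (f : borel V -> borel W).
Proof.
move=> /continuousP cf;
  apply: (@measurability _ _ (borel V) (borel W) setT f (@open W)) => //.
move=> _ [A oA <-]; rewrite setTI; apply: sub_sigma_algebra; exact: cf.
Qed.

Lemma continuous_borel_real (f : V -> R) :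
  continuous f -> measurable_fun [set: borel V] (f : borel V -> R).
Proof.
move=> /continuousP cf.
apply: (@measurability _ _ (borel V) _ setT f (@RGenOpens.G R)).
  exact: RGenOpens.measurableE.
move=> _ [_ [a [b ->] <-]]; rewrite setTI; apply: sub_sigma_algebra; apply: cf.
exact: interval_open.
Qed.

End BorelMeasurability.

Section Hilbert.
Context (R : realType) (V : hilbertType R).

Lemma dot_continuousl (y : V) : continuous (fun x : V => dot x y : R).
Proof. by move=> x; apply: cvg_dot; [exact: cvg_id|exact: cvg_cst]. Qed.

(** A complete orthonormal family enumerated by the natural numbers. Zero
    vectors are allowed as padding, so that one definition covers bases of
    finite and of infinite cardinality. *)
Definition orthonormal_seq (e : nat -> V) : Prop :=
  [/\ forall n, `|e n| = 1 \/ e n = 0,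
      forall m n, m <> n -> dot (e m) (e n) = 0
    & forall x, (forall n, dot x (e n) = 0) -> x = 0].

(** Distinct elements of an orthonormal family lie at distance at least 1, so
    each has its own point of the dense set at distance less than 1/2. *)
Lemma onb_countable (B : set V) : separable V -> is_onb B -> countable B.
Proof.
move=> [D cD dD] [B1 Borth _].
have hD (b : V) : exists d, D d /\ `|b - d| < 2^-1.
  have [||d [/= db Dd]] := dD (ball b 2^-1).
  - by exists b; exact: ballxx.
  - exact: ball_open.
  - by exists d; split => //; rewrite -ball_normE in db.
have [g hg] := choice hD.
have /countable_injP[i iD] := cD.
apply/countable_injP; exists (i \o g) => b c /set_mem Bb /set_mem Bc /= ibc.
have [Db b2] := hg b; have [Dc c2] := hg c.
have gbc : g b = g c by apply: iD => //; exact: mem_set.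
apply: contrapT => bc.
have : `|b - c| < 1.
  rewrite -[b](subrK (g b)) -addrA {2}gbc (le_lt_trans (ler_normD _ _))//.
  by rewrite (distrC (g c)); lra.
rewrite -(@ltr_pXn2r _ 2)// ?nnegrE// expr1n -dot_norm dotBl !dotBr !dot_norm.
by rewrite (B1 b)// (B1 c)// (Borth b c)// (Borth c b)//; [lra|exact/nesym].
Qed.

Lemma onb_seq (B : set V) (f : V -> \bar R) : separable V -> is_onb B ->
  (forall x, 0 <= f x)%E -> f 0 = 0%E ->
  exists2 e, orthonormal_seq e &
   (\esum_(x in B) f x = \sum_(n <oo) f (e n))%E.
Proof.
move=> sV oB f0 f00.
have [N BN] := countable_bijP _ (onb_countable sV oB).
have /card_set_bijP[g [gN gi gs]] : (N #= B)%card by rewrite card_eq_sym.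
have [B1 Borth Bc] := oB.
exists (fun n => if n \in N then g n else 0).
  split.
  - by move=> n; case: ifPn => [/set_mem Nn|_]; [left; apply/B1/gN|right].
  - move=> m n mn; case: ifPn => [Nm|_]; last by rewrite dot0l.
    case: ifPn => [Nn|_]; last by rewrite dot0r.
    apply: Borth; [exact/gN/set_mem|exact/gN/set_mem|].
    by move=> /gi mn'; apply/mn/mn'.
  - move=> x hx; apply: Bc => b /gs[n Nn <-].
    by have := hx n; rewrite mem_set.
rewrite nneseries_esumT//.
have bg : set_bij N B g by split.
rewrite (@reindex_esum _ _ _ N B g f bg).
rewrite esum_mkcond; apply: eq_esum => n _.
by case: ifPn.
Qed.

Section Expansion.
Variable e : nat -> V.
Hypothesis oe : orthonormal_seq e.

(** The n-th partial sum of the expansion of x along e. *)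
Definition partial_expansion (x : V) (n : nat) : V :=
  \sum_(i < n) dot x (e i) *: e i.

Lemma dot_partial_expansion x n k : (k < n)%N ->
  dot (partial_expansion x n) (e k) = dot x (e k).
Proof.
have [e1 eorth _] := oe; move=> kn.
rewrite dot_suml (bigD1 (Ordinal kn))//= big1 ?addr0.
  by rewrite dotZl dot_norm; case: (e1 k) => ->;
    rewrite ?normr1 ?dot0r ?expr1n ?mulr1 ?mul0r.
move=> i ik; rewrite dotZl eorth ?mulr0// => /esym ki.
by case/eqP: ik; exact/val_inj.
Qed.

Lemma dot_partial_expansionr x y n :
  dot y (partial_expansion x n) = \sum_(i < n) dot x (e i) * dot y (e i).
Proof.
by rewrite dotC dot_suml; apply: eq_bigr => i _; rewrite dotZl (dotC (e i)).
Qed.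

Lemma norm_partial_expansion x n :
  `|partial_expansion x n| ^+ 2 = \sum_(i < n) dot x (e i) ^+ 2.
Proof.
rewrite -dot_norm dot_partial_expansionr; apply: eq_bigr => i _.
by rewrite dot_partial_expansion// expr2.
Qed.

Lemma bessel x n : \sum_(i < n) dot x (e i) ^+ 2 <= `|x| ^+ 2.
Proof.
have := sqr_ge0 `|x - partial_expansion x n|.
rewrite -dot_norm dotBl !dotBr !dot_norm norm_partial_expansion.
rewrite [dot (partial_expansion _ _) _]dotC dot_partial_expansionr.
by under eq_bigr do rewrite -expr2; lra.
Qed.

Lemma norm_partial_expansionB x m n : (m <= n)%N ->
  `|partial_expansion x m - partial_expansion x n| ^+ 2 =
  \sum_(i < n) dot x (e i) ^+ 2 - \sum_(i < m) dot x (e i) ^+ 2.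
Proof.
move=> mn; rewrite -dot_norm dotBl !dotBr !dot_norm !norm_partial_expansion.
have Pmn : dot (partial_expansion x n) (partial_expansion x m) =
    \sum_(i < m) dot x (e i) ^+ 2.
  rewrite dot_partial_expansionr; apply: eq_bigr => i _.
  by rewrite dot_partial_expansion ?expr2// (leq_trans (ltn_ord i)).
rewrite (dotC (partial_expansion x m)) Pmn.
by ring.
Qed.

Lemma partial_expansion_cvg x : partial_expansion x @ \oo --> x.
Proof.
pose s n : R := \sum_(i < n) dot x (e i) ^+ 2.
have nds : nondecreasing_seq s.
  move=> m n mn; rewrite -subr_ge0 -norm_partial_expansionB//; exact: sqr_ge0.
have ubs : has_ubound (range s).
  by exists (`|x| ^+ 2) => _ [n _ <-]; exact: bessel.
have sle n : s n <= sup (range s) by apply: ub_le_sup => //; exists n.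
have ssup : has_sup (range s) by split => //; exists (s 0), 0.
have : cvg (partial_expansion x @ \oo).
  apply/cauchy_cvgP; apply: cauchy_exP => _/posnumP[eps].
  have [_ [N _ <-] sN] := sup_adherent (exprn_gt0 2 [gt0 of eps%:num]) ssup.
  exists (partial_expansion x N); exists N => // n /= Nn.
  rewrite -ball_normE/= -(@ltr_pXn2r _ 2)// ?nnegrE//.
  rewrite norm_partial_expansionB// -/(s n) -/(s N).
  by have := sle n; lra.
move=> /cvg_ex[y Py]; suff xy : x - y = 0.
  by move/subr0_eq : xy => xy; rewrite -xy in Py.
have [_ _ ec] := oe; apply: ec => k; rewrite dotBl.
have h : dot (partial_expansion x n) (e k) @[n --> \oo] --> (dot y (e k) : R).
  by apply: cvg_dot; [exact: Py|exact: cvg_cst].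
have h' : dot (partial_expansion x n) (e k) @[n --> \oo] --> (dot x (e k) : R).
  apply: cvg_near_cst; exists k.+1 => // n /= kn.
  exact: dot_partial_expansion.
by rewrite (cvg_unique _ h h')// subrr.
Qed.

Lemma parseval x : \sum_(i < n) dot x (e i) ^+ 2 @[n --> \oo] --> `|x| ^+ 2.
Proof.
rewrite -dot_norm; under eq_fun do rewrite -norm_partial_expansion -dot_norm.
by apply: cvg_dot; exact: partial_expansion_cvg.
Qed.

End Expansion.
End Hilbert.

Section DistanceMeasurability.
Context (R : realType) (V : hilbertType R) (e : nat -> V).
Hypothesis oe : orthonormal_seq e.

(** The distance is measurable for the product of the Borel sigma-algebras: by
    Parseval's identity its square is a limit of sums of squares of differences
    of coordinates. *)
Lemma measurable_dist :
  measurable_fun [set: borel V * borel V] (fun z => `|(z.1 : V) - (z.2 : V)|).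
Proof.
have -> : (fun z : borel V * borel V => `|(z.1 : V) - (z.2 : V)|) =
    Num.sqrt \o (fun z => `|(z.1 : V) - (z.2 : V)| ^+ 2).
  by apply/funext => z /=; rewrite sqrtr_sqr normr_id.
apply: measurableT_comp.
  exact: (continuous_measurable_fun (@sqrt_continuous R)).
have mdot i :
    measurable_fun [set: borel V] (fun x : borel V => dot (x : V) (e i)).
  exact: (continuous_borel_real (@dot_continuousl _ _ (e i))).
pose s n (z : borel V * borel V) : R :=
  \sum_(i < n) (dot (z.1 : V) (e i) - dot (z.2 : V) (e i)) ^+ 2.
apply: (@measurable_fun_cvg _ _ _ _ s) => [n|z _].
  apply: measurable_sum => i; apply: measurable_funX; apply: measurable_funB.
    exact: (measurableT_comp (mdot i) measurable_fst).
  exact: (measurableT_comp (mdot i) measurable_snd).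
have := @parseval _ _ _ oe ((z.1 : V) - (z.2 : V)).
by under eq_fun do under eq_bigr do rewrite dotBl.
Qed.

End DistanceMeasurability.

(** * Measures given by a density *)

Section Density.
Context d (T : measurableType d) (R : realType).
Variable mu : {measure set T -> \bar R}.
Local Open Scope ereal_scope.

(** The finite measure with density g with respect to mu. The set function does
    not depend on the proof arguments; they carry the conditions under which it
    is a finite measure. *)
Definition mdensity (g : T -> R) of measurable_fun [set: T] g
    & (forall x, (0 <= g x)%R) & \int[mu]_x (g x)%:E < +oo : set T -> \bar R :=
  fun A => \int[mu]_(x in A) (g x)%:E.

Section instance.
Variables (g : T -> R) (mg : measurable_fun [set: T] g).
Hypothesis g0 : forall x, (0 <= g x)%R.
Hypothesis gfin : \int[mu]_x (g x)%:E < +oo.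

Let mdensity0 : mdensity mg g0 gfin set0 = 0.
Proof. exact: integral_set0. Qed.

Let mdensity_ge0 A : 0 <= mdensity mg g0 gfin A.
Proof. by apply: integral_ge0 => x _; rewrite lee_fin. Qed.

Let mdensity_sigma_additive : semi_sigma_additive (mdensity mg g0 gfin).
Proof.
move=> /= A mA tA mUA; rewrite /mdensity ge0_integral_bigcup//=.
- apply: is_cvg_ereal_nneg_natsum_cond => n _ _.
  by apply: integral_ge0 => x ?; rewrite lee_fin.
- by apply/measurable_EFinP; exact: measurable_funTS.
- by move=> x _; rewrite lee_fin.
Qed.

HB.instance Definition _ := isMeasure.Build _ _ _ (mdensity mg g0 gfin)
  mdensity0 mdensity_ge0 mdensity_sigma_additive.

Let mdensity_finite : fin_num_fun (mdensity mg g0 gfin).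
Proof.
by apply: lty_fin_num_fun => /=; exact: gfin.
Qed.

HB.instance Definition _ := Measure_isFinite.Build _ _ _ (mdensity mg g0 gfin)
  mdensity_finite.

End instance.

(** The same measure as a probability, when its total mass is 1. *)
Definition pdensity (g : T -> R) (mg : measurable_fun [set: T] g)
    (g0 : forall x, (0 <= g x)%R) (gfin : \int[mu]_x (g x)%:E < +oo)
    of \int[mu]_x (g x)%:E = 1 : set T -> \bar R := mdensity mg g0 gfin.

Section pinstance.
Variables (g : T -> R) (mg : measurable_fun [set: T] g).
Hypothesis g0 : forall x, (0 <= g x)%R.
Hypothesis gfin : \int[mu]_x (g x)%:E < +oo.
Hypothesis g1 : \int[mu]_x (g x)%:E = 1.

HB.instance Definition _ := Measure.on (pdensity mg g0 gfin g1).

HB.instance Definition _ :=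
  Measure_isProbability.Build _ _ _ (pdensity mg g0 gfin g1) g1.

End pinstance.

Import HBNNSimple.

(** Integration against a measure with a density, by monotone approximation
    with simple functions. *)
Lemma ge0_integral_density (nu : {measure set T -> \bar R}) (g : T -> R)
    (f : T -> \bar R) :
  measurable_fun [set: T] g -> (forall x, (0 <= g x)%R) ->
  (forall A, measurable A -> nu A = \int[mu]_(x in A) (g x)%:E) ->
  measurable_fun [set: T] f -> (forall x, 0 <= f x) ->
  \int[nu]_x f x = \int[mu]_x (f x * (g x)%:E).
Proof.
move=> mg g0 nuE mf f0; pose h := nnsfun_approx measurableT mf.
have mh n : measurable_fun [set: T] (EFin \o h n).
  by apply/measurable_EFinP; exact/measurable_funP.
have hf x : (EFin \o h n) x @[n --> \oo] --> f x.
  by apply: cvg_nnsfun_approx => // *; exact: f0.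
have h1 : \int[nu]_x (EFin \o h n) x @[n --> \oo] --> \int[nu]_x f x.
  under eq_integral do rewrite -(cvg_lim _ (hf _))//.
  apply: cvg_monotone_convergence => //.
  - by move=> n x _; rewrite lee_fin.
  - by move=> x _ a b ab; rewrite lee_fin; exact/lefP/nd_nnsfun_approx.
have hfg x : (EFin \o h n) x * (g x)%:E @[n --> \oo] --> f x * (g x)%:E.
  exact: cvgeZr.
have h2 : \int[mu]_x ((EFin \o h n) x * (g x)%:E) @[n --> \oo] -->
    \int[mu]_x (f x * (g x)%:E).
  under eq_integral do rewrite -(cvg_lim _ (hfg _))//.
  apply: cvg_monotone_convergence => //.
  - by move=> n; apply: emeasurable_funM => //; exact/measurable_EFinP.
  - by move=> n x _; rewrite mule_ge0// lee_fin.
  - move=> x _ a b ab; rewrite lee_wpmul2r ?lee_fin//.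
    exact/lefP/nd_nnsfun_approx.
apply: (cvg_unique _ h1); first exact: ereal_hausdorff.
suff E n : \int[nu]_x (EFin \o h n) x = \int[mu]_x ((EFin \o h n) x * (g x)%:E).
  by apply: cvg_trans h2; apply: near_eq_cvg; apply: nearW => n; rewrite E.
have hE x : (EFin \o h n) x =
    \sum_(y \in range (h n)) (y * \1_(h n @^-1` [set y]) x)%:E.
  by rewrite /= fimfunE -fsumEFin.
have m1 r :
    measurable_fun [set: T] (fun x => (r * \1_(h n @^-1` [set r]) x)%:E).
  by apply/measurable_EFinP; exact: measurable_funM.
have p1 r x : 0 <= (r * \1_(h n @^-1` [set r]) x)%:E.
  exact: nnfun_muleindic_ge0.
under eq_integral do rewrite hE.
under [RHS]eq_integral do rewrite hE ge0_mule_fsuml//.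
rewrite ge0_integral_fsum// ge0_integral_fsum//; last 2 first.
  - by move=> r; apply: emeasurable_funM => //; exact/measurable_EFinP.
  - by move=> r x _; rewrite mule_ge0// lee_fin.
apply: eq_fsbigr => r /set_mem[x _ <-].
set A := h n @^-1` _.
have mA : measurable A by exact: measurable_sfunP.
have r0 : (0 <= h n x)%R by [].
have mA1 : measurable_fun [set: T] (fun x => (\1_A x : R)%:E).
  exact/measurable_EFinP.
transitivity ((h n x)%:E * nu A).
  under eq_integral do rewrite EFinM.
  by rewrite ge0_integralZl ?lee_fin//= integral_indic// setIT.
under [RHS]eq_integral do rewrite EFinM -muleA.
rewrite ge0_integralZl//; last 2 first.
- apply: emeasurable_funM => //; exact/measurable_EFinP.
- by move=> y _; rewrite mule_ge0// lee_fin.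
congr (_ * _); rewrite nuE// integral_mkcond; apply: eq_integral => y _.
by rewrite epatch_indic muleC.
Qed.

End Density.

(** * Exponential moments of Gaussian measures *)

Lemma measurable_fun_expR d (T : measurableType d) (R : realType) (g : T -> R) :
  measurable_fun [set: T] g -> measurable_fun [set: T] (fun x => expR (g x)).
Proof. by move=> mg; exact: measurableT_comp (@measurable_expR R) mg. Qed.

Section NormalExponentialMoment.
Context (R : realType).

(** Half of the Gaussian exponent can be absorbed: the product is, up to a
    constant, the density of twice the variance. *)
Lemma normal_pdf_expo (s x : R) : s != 0 ->
  expR (x ^+ 2 / (4 * s ^+ 2)) * normal_pdf 0 s x =
  Num.sqrt 2 * normal_pdf 0 (Num.sqrt 2 * s) x.
Proof.
move=> s0; have s20 : Num.sqrt 2 != 0 :> R by rewrite sqrtr_eq0 -ltNge.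
rewrite !normal_pdfE ?mulf_neq0// /normal_peak /normal_fun !subr0.
rewrite mulrCA [RHS]mulrA -expRD exprMn sqr_sqrtr//; congr (_ * expR _).
  rewrite -[2 * _ * _]mulrA -[2 * _ *+ 2]mulrnAr [in RHS]sqrtrM//.
  by rewrite invfM mulrA mulfV// mul1r.
by rewrite -[s ^+ 2 *+ 2]mulr_natl -[2 * _ *+ 2]mulr_natl; field.
Qed.

Lemma normal_expo_le (s v : R) : s != 0 -> s ^+ 2 <= v ->
  (\int[normal_prob 0 s]_x (expR (x ^+ 2 / (4 * v)))%:E <= (Num.sqrt 2)%:E)%E.
Proof.
move=> s0 sv.
have s2 : 0 < s ^+ 2 by rewrite exprn_even_gt0.
have mexp c : measurable_fun [set: R] (fun x : R => (expR (x ^+ 2 / c))%:E).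
  apply/measurable_EFinP; apply: measurable_fun_expR.
  have mX : measurable_fun [set: R] (fun x : R => x ^+ 2).
    exact: measurable_funX.
  exact: measurable_funM mX (measurable_cst _).
have mpdf t : measurable_fun [set: R] (fun x => (normal_pdf 0 t x)%:E).
  by apply/measurable_EFinP; exact: measurable_normal_pdf.
rewrite (@ge0_integral_density _ _ _ lebesgue_measure (normal_prob 0 s)
  (normal_pdf 0 s) _ (@measurable_normal_pdf _ 0 s) (normal_pdf_ge0 0 s)
  (fun _ _ => erefl) (mexp _)); last by move=> x; rewrite lee_fin expR_ge0.
have -> : (Num.sqrt 2)%:E =
    (\int[lebesgue_measure]_x
      (Num.sqrt 2 * normal_pdf 0 (Num.sqrt 2 * s) x)%:E)%E.
  under eq_integral do rewrite EFinM.
  rewrite ge0_integralZl//=;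
    [|exact: mpdf|by move=> x _; rewrite lee_fin normal_pdf_ge0].
  by rewrite integral_normal_pdf mule1.
apply: ge0_le_integral => //=.
- by move=> x _; rewrite mule_ge0 ?lee_fin ?expR_ge0 ?normal_pdf_ge0.
- exact: emeasurable_funM (mexp _) (mpdf _).
- apply/measurable_EFinP.
  exact: measurable_funM (measurable_cst _) (@measurable_normal_pdf _ _ _).
- move=> x _; rewrite -EFinM lee_fin -normal_pdf_expo//.
  rewrite ler_wpM2r ?normal_pdf_ge0// ler_expR ler_wpM2l ?sqr_ge0//.
  have v0 := lt_le_trans s2 sv.
  have s4 : 0 < 4 * s ^+ 2 by rewrite pmulr_rgt0.
  by rewrite lef_pV2 ?posrE ?ler_wpM2l// pmulr_rgt0.
Qed.

End NormalExponentialMoment.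

Section GaussianMoments.
Context (R : realType) (V : hilbertType R) (C0 : {linear V -> V}).
Variable mu0 : probability (borel V) R.
Hypothesis gauss : is_centered_gaussian C0 mu0.
Local Open Scope ereal_scope.

Lemma gaussian_marginal_expo (y : V) (w : R) :
  (dot (C0 y) y <= w)%R -> (0 < w)%R ->
  \int[mu0]_u (expR (dot (u : V) y ^+ 2 / (4 * w)))%:E <= (Num.sqrt 2)%:E.
Proof.
have [[_ _ C0pos] _ marg] := gauss; move=> yw w0.
pose f (x : measurableTypeR R) := (expR (x ^+ 2 / (4 * w)))%:E.
have mf : measurable_fun [set: measurableTypeR R] f.
  apply/measurable_EFinP; apply: measurable_fun_expR.
  have mX : measurable_fun [set: R] (fun x : R => x ^+ 2)%R.
    exact: measurable_funX.
  exact: measurable_funM mX (measurable_cst _).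
pose phi (u : borel V) : measurableTypeR R := dot (u : V) y.
have mphi : measurable_fun setT phi.
  exact: (continuous_borel_real (@dot_continuousl _ _ y)).
have -> : \int[mu0]_u (expR (dot (u : V) y ^+ 2 / (4 * w)))%:E =
    \int[pushforward mu0 phi]_x f x.
  by rewrite ge0_integral_pushforward// => x _; rewrite lee_fin expR_ge0.
have E A : measurable A ->
    pushforward mu0 phi A = centered_normal (dot (C0 y) y) A.
  by move=> mA; rewrite -marg.
rewrite /centered_normal in E; case: eqVneq E => [_|v0] E.
  rewrite (@eq_measure_integral _ _ _ _ (\d_(0%R : measurableTypeR R)))//;
    last by move=> A mA _; exact: E.
  rewrite integral_dirac// diracE in_setT mul1e /f expr0n/= mul0r expR0 lee_fin.
  by rewrite -[leLHS]sqrtr1 ler_wsqrtr// ler1n.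
have v_gt0 : (0 < dot (C0 y) y)%R by rewrite lt_neqAle eq_sym v0 C0pos.
have -> : \int[pushforward mu0 phi]_x f x =
    \int[normal_prob 0 (Num.sqrt (dot (C0 y) y))]_x f x.
  by apply: eq_measure_integral => A mA _; exact: E.
by apply: normal_expo_le; rewrite ?sqr_sqrtr ?C0pos// sqrtr_eq0 -ltNge.
Qed.

End GaussianMoments.

Section JensenExp.
Context (R : realType).

(** Jensen's inequality for the exponential, the weight missing from 1 being
    put on the point 0. *)
Lemma expR_sum_le (n : nat) (w y : 'I_n -> R) :
  (forall i, 0 <= w i) -> \sum_i w i <= 1 ->
  expR (\sum_i w i * y i) <= \sum_i w i * expR (y i) + (1 - \sum_i w i).
Proof.
move=> w0; set a := \sum_i w i * y i; set W := \sum_i w i => W1.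
(* the exponential lies above its tangent at a *)
have tangent (x : R) : expR a * (1 + (x - a)) <= expR x.
  rewrite -[x in leRHS](subrK a) [x - a + a]addrC expRD.
  by rewrite ler_wpM2l ?expR_ge0// expR_ge1Dx.
have h1 : \sum_i w i * (expR a * (1 + (y i - a))) <= \sum_i w i * expR (y i).
  by apply: ler_sum => i _; rewrite ler_wpM2l.
have h2 : \sum_i w i * (expR a * (1 + (y i - a))) = expR a * (W + a - W * a).
  transitivity (\sum_i expR a * (w i + w i * y i - w i * a)).
    by apply: eq_bigr => i _; ring.
  by rewrite -mulr_sumr sumrB big_split/= -mulr_suml.
have h3 : (1 - W) * (expR a * (1 + (0 - a))) <= (1 - W) * 1.
  by rewrite ler_wpM2l ?subr_ge0//; have := tangent 0; rewrite expR0.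
rewrite h2 in h1; nra.
Qed.

(** With q = p / 2 and k = c / q, raise k * x ^+ 2 <= expR (k * x ^+ 2) to the
    power q. *)
Lemma powR_le_expo (c p : R) : 0 < c -> 0 < p ->
  exists2 C, 0 <= C & forall x, 0 <= x -> x `^ p <= C * expR (c * x ^+ 2).
Proof.
move=> c0 p0; pose q := p / 2; pose k := c / q.
have q0 : 0 < q by rewrite divr_gt0.
have k0 : 0 < k by rewrite divr_gt0.
exists (k `^ q)^-1; first by rewrite invr_ge0 powR_ge0.
move=> x x0; rewrite ler_pdivlMl ?powR_gt0//.
have -> : x `^ p = (x ^+ 2) `^ q.
  by rewrite -powR_mulrn// -powRrM; congr (_ `^ _); rewrite /q; field.
have kx0 : 0 <= k * x ^+ 2 by rewrite mulr_ge0 ?exprn_ge0// ltW.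
rewrite -powRM ?exprn_ge0//; last exact: ltW.
have -> : c * x ^+ 2 = (k * x ^+ 2) * q by rewrite /k; field; rewrite gt_eqF.
rewrite expRM; apply: ge0_ler_powR; rewrite ?nnegrE ?expR_ge0//.
  exact: ltW.
by apply: le_trans (expR_ge1Dx _); rewrite lerDr.
Qed.

Lemma sum_half_le1 (n : nat) : \sum_(i < n) (2^-1 : R) ^+ i.+1 <= 1.
Proof.
suff -> : \sum_(i < n) (2^-1 : R) ^+ i.+1 = 1 - 2^-1 ^+ n.
  by rewrite lerBlDr lerDl exprn_ge0.
elim: n => [|n IHn]; first by rewrite big_ord0 subrr.
by rewrite big_ord_recr/= IHn exprS; field.
Qed.

End JensenExp.

Section GaussianTails.
Context (R : realType) (V : hilbertType R) (C0 : {linear V -> V}).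
Variable mu0 : probability (borel V) R.
Hypotheses (sepV : separable V) (gauss : is_centered_gaussian C0 mu0).
Local Open Scope ereal_scope.

(** The covariance has finite trace along an enumerated orthonormal basis. *)
Lemma gaussian_trace_seq : exists (e : nat -> V) (S : R), orthonormal_seq e /\
  forall n, (\sum_(i < n) dot (C0 (e i)) (e i) <= S)%R.
Proof.
have [[_ _ C0pos] trC _] := gauss.
have [B oB trB] : exists2 B, is_onb B &
    trace C0 = \esum_(x in B) (dot (C0 x) x)%:E.
  have [[_ [B oB _]]|nB] := pselect (exists t, [set t | exists2 B, is_onb B &
      t = (\esum_(x in B) (dot (C0 x) x)%:E)] t).
    have [B' oB' tB'] := xgetPex +oo (ex_intro
      [set t | exists2 B, is_onb B & t = (\esum_(x in B) (dot (C0 x) x)%:E)] _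
      (ex_intro2 _ _ B oB erefl)).
    by exists B'.
  move: trC; rewrite /trace xgetPN ?ltxx// => t tB.
  by apply: nB; exists t.
have [||e oe esumE] := onb_seq (f := fun x => (dot (C0 x) x)%:E) sepV oB.
- by move=> x; rewrite lee_fin.
- by rewrite dot0r.
rewrite trB esumE in trC.
set S := \sum_(n <oo) _ in trC.
have Sfin : S \is a fin_num.
  by rewrite ge0_fin_numE//; apply: nneseries_ge0 => n _ _; rewrite lee_fin.
exists e, (fine S); split => // n.
rewrite -lee_fin fineK// -sumEFin.
rewrite -(big_mkord xpredT (fun i => (dot (C0 (e i)) (e i))%:E)).
by apply: nneseries_lim_ge => i _ _; rewrite lee_fin.
Qed.

(** Fernique's theorem for the Gaussian measure. By Jensen's inequality with
    weights proportional to the variances along an orthonormal basis, the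
    bound reduces to the one-dimensional marginals; no independence of the
    coordinates is needed. *)
Lemma fernique : exists2 c : R, (0 < c)%R &
  \int[mu0]_u (expR (c * `|u : V| ^+ 2))%:E < +oo.
Proof.
have [e [S0 [oe hS0]]] := gaussian_trace_seq.
have [[_ _ C0pos] _ _] := gauss.
(* the summable perturbation 2^-(i+1) makes all the weights positive *)
pose v i : R := (dot (C0 (e i)) (e i) + 2^-1 ^+ i.+1)%R.
have v0 i : (0 < v i)%R by rewrite ltr_wpDl// exprn_gt0.
pose S : R := (S0 + 1)%R.
have vS n : (\sum_(i < n) v i <= S)%R.
  by rewrite big_split/= lerD ?hS0 ?sum_half_le1.
have S_gt0 : (0 < S)%R.
  by apply: lt_le_trans (vS 1%N); rewrite big_ord1.
pose s n (u : V) : R := (\sum_(i < n) dot u (e i) ^+ 2)%R.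
have ms n : measurable_fun [set: borel V]
    (fun u : borel V => (expR (s n u / (4 * S)))%:E).
  apply/measurable_EFinP; apply: measurable_fun_expR.
  apply: measurable_funM => //; apply: measurable_sum => i.
  apply: measurable_funX.
  exact: (continuous_borel_real (@dot_continuousl _ _ (e i))).
have mi i : measurable_fun [set: borel V]
    (fun u : borel V => (expR (dot (u : V) (e i) ^+ 2 / (4 * v i)))%:E).
  apply/measurable_EFinP; apply: measurable_fun_expR.
  apply: measurable_funM => //.
  apply: measurable_funX.
  exact: (continuous_borel_real (@dot_continuousl _ _ (e i))).
have bound n : \int[mu0]_u (expR (s n u / (4 * S)))%:E <= (Num.sqrt 2)%:E.
  pose w (i : 'I_n) := (v i / S)%R.
  have w0 i : (0 <= w i)%R by rewrite divr_ge0 ?ltW.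
  have w1 : (\sum_i w i <= 1)%R by rewrite -mulr_suml ler_pdivrMr ?mul1r.
  apply: (@le_trans _ _ (\int[mu0]_u
     (\sum_(i < n) (w i)%:E * (expR (dot (u : V) (e i) ^+ 2 / (4 * v i)))%:E +
      (1 - \sum_i w i)%:E))).
    apply: ge0_le_integral => //.
    - apply: emeasurable_funD; last exact: measurable_cst.
      apply: emeasurable_sum => i.
      by apply: emeasurable_funM => //; exact: measurable_cst.
    move=> u _; under eq_bigr do rewrite -EFinM; rewrite sumEFin -EFinD lee_fin.
    apply: le_trans (expR_sum_le _ w0 w1); rewrite ler_expR mulr_suml.
    apply: ler_sum => i _; rewrite /w le_eqVlt; apply/orP; left; apply/eqP.
    by field; rewrite !gt_eqF.
  have mwi (i : 'I_n) : measurable_fun [set: borel V]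
     (fun u : borel V =>
        (w i)%:E * (expR (dot (u : V) (e i) ^+ 2 / (4 * v i)))%:E).
    by apply: emeasurable_funM => //; exact: measurable_cst.
  have sum0 (u : borel V) : [set: borel V] u ->
      0 <= \sum_(i < n)
             (w i)%:E * (expR (dot (u : V) (e i) ^+ 2 / (4 * v i)))%:E.
    by move=> _; apply: sume_ge0 => i _; rewrite mule_ge0 ?lee_fin ?expR_ge0.
  have msum : measurable_fun [set: borel V] (fun u : borel V =>
      \sum_(i < n) (w i)%:E * (expR (dot (u : V) (e i) ^+ 2 / (4 * v i)))%:E).
    exact: emeasurable_sum.
  have cst0 (u : borel V) : [set: borel V] u -> 0 <= (1 - \sum_i w i)%:E.
    by rewrite lee_fin subr_ge0.
  rewrite ge0_integralD//=.
  rewrite integral_cst// [X in _ + _ * X <= _](probability_setT mu0) mule1.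
  rewrite ge0_integral_sum//; last first.
    by move=> i u _; rewrite mule_ge0 ?lee_fin ?expR_ge0.
  apply: (@le_trans _ _ (\sum_(i < n) (w i)%:E * (Num.sqrt 2)%:E +
                         (1 - \sum_i w i)%:E)).
    rewrite leeD2r//; apply: lee_sum => i _.
    rewrite ge0_integralZl//=; last by rewrite lee_fin.
    rewrite lee_wpmul2l ?lee_fin//; apply: (gaussian_marginal_expo gauss) => //.
    by rewrite /v lerDl exprn_ge0.
  under eq_bigr do rewrite -EFinM; rewrite sumEFin -EFinD lee_fin -mulr_suml.
  have : (1 <= Num.sqrt 2 :> R)%R by rewrite -[leLHS]sqrtr1 ler_wsqrtr// ler1n.
  by nra.
exists (4 * S)^-1%R; first by rewrite invr_gt0 mulr_gt0.
apply: (@le_lt_trans _ _ (Num.sqrt 2)%:E); last exact: ltry.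
have scvg (u : V) : (expR (s n u / (4 * S)))%:E @[n --> \oo] -->
    (expR ((4 * S)^-1 * `|u| ^+ 2))%:E.
  apply: cvg_EFin; first exact: nearW.
  apply: continuous_cvg; first exact: continuous_expR.
  rewrite [((4 * S)^-1 * _)%R]mulrC; apply: cvgM; last exact: cvg_cst.
  exact: parseval.
suff h : \int[mu0]_u (expR (s n u / (4 * S)))%:E @[n --> \oo] -->
    \int[mu0]_u (expR ((4 * S)^-1 * `|u : V| ^+ 2))%:E.
  by apply: cvge_le h; exact: nearW.
under eq_integral do rewrite -(cvg_lim _ (scvg _))//.
apply: cvg_monotone_convergence => //.
move=> x _ a b ab; rewrite lee_fin ler_expR.
rewrite ler_wpM2r ?invr_ge0 ?mulr_ge0 ?(ltW S_gt0)//.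
by rewrite -subr_ge0 -(norm_partial_expansionB oe)// sqr_ge0.
Qed.

End GaussianTails.

(** * Moments of the prior *)

Section PushforwardMoments.
Context (R : realType) (V : hilbertType R) (mu0 : probability (borel V) R).
Local Open Scope ereal_scope.

Lemma measurable_norm_powR (p : R) :
  measurable_fun [set: borel V] (fun u : borel V => (`|u : V| `^ p)%R).
Proof.
have mnorm : measurable_fun [set: borel V] (fun u : borel V => `|u : V|%R).
  exact: (continuous_borel_real (@norm_continuous _ V)).
exact: (measurableT_comp (@measurable_powR R p) mnorm).
Qed.

(** The p-th power of |f u| is dominated by expR (c / 2 * |f u| ^+ 2), and
    |f u| ^+ 2 by 2 * |u| ^+ 2 + 2 * B ^+ 2. *)
Lemma pushforward_moment_fin (f : V -> V) (B c p : R) :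
  continuous f -> (forall u, (`|f u - u| <= B)%R) ->
  (0 < c)%R -> \int[mu0]_u (expR (c * `|u : V| ^+ 2))%:E < +oo ->
  (0 < p)%R ->
  \int[pushforward mu0 (f : borel V -> borel V)]_u (`|u : V| `^ p)%:E < +oo.
Proof.
move=> cf fB c0 expfin p0.
have mf : measurable_fun [set: borel V] (f : borel V -> borel V).
  exact: continuous_borel_measurable.
have mn : measurable_fun [set: borel V] (fun u : borel V => (`|u : V| `^ p)%:E).
  by apply/measurable_EFinP; exact: measurable_norm_powR.
rewrite ge0_integral_pushforward//.
rewrite preimage_setT.
have c2 : (0 < c / 2)%R by rewrite divr_gt0.
have [C C0 hC] := powR_le_expo c2 p0.
pose K := (C * expR (c * B ^+ 2))%R.
have K0 : (0 <= K)%R by rewrite mulr_ge0// expR_ge0.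
have mexp : measurable_fun [set: borel V]
    (fun u : borel V => (expR (c * `|u : V| ^+ 2))%:E).
  have mnorm : measurable_fun [set: borel V] (fun u : borel V => `|u : V|%R).
    exact: (continuous_borel_real (@norm_continuous _ V)).
  apply/measurable_EFinP; apply: measurable_fun_expR.
  apply: (measurable_funM (measurable_cst _)).
  exact: (measurable_funX 2 mnorm).
apply: (@le_lt_trans _ _ (\int[mu0]_u (K%:E * (expR (c * `|u : V| ^+ 2))%:E))).
  apply: ge0_le_integral => //.
  - by move=> u _; rewrite lee_fin powR_ge0.
  - exact: (measurableT_comp mn mf).
  - by apply: emeasurable_funM => //; exact: measurable_cst.
  move=> u _; rewrite -EFinM lee_fin /=.
  apply: le_trans (hC _ (normr_ge0 _)) _.
  rewrite /K -[leRHS]mulrA ler_wpM2l// -expRD ler_expR.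
  have h1 : (`|f u| <= `|u : V| + B)%R.
    by rewrite -[f u](subrK u) addrC (le_trans (ler_normD _ _))// lerD2l.
  have h2 : (`|f u| ^+ 2 <= 2 * (`|u : V| ^+ 2 + B ^+ 2))%R.
    have : (`|f u| ^+ 2 <= (`|u : V| + B) ^+ 2)%R.
      rewrite ler_pXn2r// nnegrE//; exact: le_trans h1.
    by have := sqr_ge0 (`|u : V| - B)%R; lra.
  by have : (0 < c)%R := c0; nra.
rewrite ge0_integralZl//.
by rewrite lte_mul_pinfty// lee_fin.
Qed.

End PushforwardMoments.

(** * Dominated convergence along a parameter *)

Section DominatedConvergenceParameter.
Context (R : realType) (Y : pseudoMetricType R).

(** Heine's criterion: limits along a metric filter are tested on sequences. *)
Lemma cvg_of_sequences (Z : topologicalType) (G : Y -> Z) (y0 : Y) (l : Z) :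
  (forall u : nat -> Y, u @ \oo --> y0 -> G (u n) @[n --> \oo] --> l) ->
  G y @[y --> y0] --> l.
Proof.
move=> hG A lA; apply: contrapT => nA.
have hn (n : nat) : exists y, ball y0 n.+1%:R^-1 y /\ ~ A (G y).
  apply: contrapT => hy; apply: nA.
  have : nbhs y0 (ball y0 (n.+1%:R^-1 : R)) by exact: nbhsx_ballx.
  apply: filterS => y yb; apply: contrapT => Ay; apply: hy.
  by exists y.
have [u hu] := choice hn.
have uy0 : u @ \oo --> y0.
  apply/cvg_ballP => eps eps0.
  near=> n; apply: (@le_ball _ _ _ n.+1%:R^-1); last by have [] := hu n.
  by apply/ltW; near: n; exact: (near_infty_natSinv_lt (PosNum eps0)).
have [N _ NA] := hG u uy0 A lA.
by have [_] := hu N; apply; exact: (NA N (leqnn N)).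
Unshelve. all: by end_near. Qed.

Context d (T : measurableType d) (mu : {measure set T -> \bar R}).
Local Open Scope ereal_scope.

(** Dominated convergence for integrals depending on a parameter. *)
Lemma dominated_cvg_param (g : Y -> T -> R) (y0 : Y) (b : T -> R) :
  (forall y, measurable_fun [set: T] (g y)) ->
  (forall x, g y x @[y --> y0] --> g y0 x) ->
  (\forall y \near y0, forall x, (`|g y x| <= b x)%R) ->
  measurable_fun [set: T] b -> \int[mu]_x (b x)%:E < +oo ->
  \int[mu]_x (g y x)%:E @[y --> y0] --> \int[mu]_x (g y0 x)%:E.
Proof.
move=> mg gcvg gb mb bfin; apply: cvg_of_sequences => u uy0.
have [N _ Nb] := uy0 _ gb.
rewrite -(cvg_shiftn N).
have b0 x : (0 <= b x)%R.
  by apply: le_trans (Nb N (leqnn N) x); exact: normr_ge0.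
apply: (@dominated_cvg _ _ _ _ _ _ _ _ (EFin \o b)) => //.
- by move=> n; exact/measurable_EFinP.
- move=> x _; apply: cvg_EFin; first exact: nearW.
  have : g (u n) x @[n --> \oo] --> g y0 x.
    exact: (cvg_comp _ (fun y => g y x) uy0 (gcvg x)).
  by rewrite -(cvg_shiftn N).
- apply/integrableP; split; first exact/measurable_EFinP.
  by under eq_integral do rewrite /= ger0_norm//.
- move=> n x _; rewrite /= lee_fin; apply: (Nb (n + N)%N); exact: leq_addl.
Qed.

End DominatedConvergenceParameter.

(** * Comparison of the distances between probability measures *)

Section DistanceComparison.
Context (R : realType) (V : hilbertType R).
Implicit Types (mu nu : probability (borel V) R).
Local Open Scope ereal_scope.

Lemma tv_dist_ge mu nu (B : set (borel V)) : measurable B ->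
  `|mu B - nu B| <= tv_dist mu nu.
Proof. by move=> mB; apply: ereal_sup_ubound; exists B. Qed.

Lemma tv_dist_ge0 mu nu : 0 <= tv_dist mu nu.
Proof. by apply: le_trans (tv_dist_ge mu nu measurable0); exact: abse_ge0. Qed.

Lemma measure_le_tv mu nu (B : set (borel V)) : measurable B ->
  mu B <= nu B + tv_dist mu nu.
Proof.
move=> mB; have nufin : nu B \is a fin_num by exact: fin_num_measure.
rewrite -leeBlDl//; apply: le_trans (tv_dist_ge mu nu mB); exact: lee_abs.
Qed.

Lemma tv_distC mu nu : tv_dist mu nu = tv_dist nu mu.
Proof.
have E (m1 m2 : probability (borel V) R) (B : set (borel V)) :
    measurable B -> `|m1 B - m2 B| = `|m2 B - m1 B|.
  by move=> mB; rewrite -abseN fin_num_oppeB ?fin_num_measure// addeC.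
congr ereal_sup; apply/seteqP.
by split => _ [B mB <-]; exists B => //; exact: E.
Qed.

Lemma open_enlargement (e : R) (B : set V) : open (enlargement e B).
Proof.
rewrite openE => x [y By xy]; rewrite /interior.
have exy : (0 < e - `|x - y|)%R by rewrite subr_gt0.
apply/nbhs_normP; exists (e - `|x - y|)%R => //= z /= xz.
exists y => //; rewrite -[z](subrK x) -addrA.
rewrite (le_lt_trans (ler_normD _ _))// distrC.
by rewrite -ltrBrDr.
Qed.

Lemma prokhorov_dist_ge0 mu nu : 0 <= prokhorov_dist mu nu.
Proof. by apply: le_ereal_inf_tmp => _ [e [e0 _] <-]; rewrite lee_fin ltW. Qed.

(** The total variation distance plus any positive number is admissible in the
    infimum, because a set is contained in its enlargements. *)
Lemma prokhorov_le_tv mu nu : prokhorov_dist mu nu <= tv_dist mu nu.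
Proof.
apply/lee_addgt0Pr => eps eps0.
have := tv_dist_ge0 mu nu.
case E : (tv_dist mu nu) => [t| |]// t0; last by rewrite leey.
rewrite lee_fin in t0.
have te0 : (0 < t + eps)%R by rewrite ltr_wpDl.
apply: ereal_inf_lbound; exists (t + eps)%R => //; split => // B mB.
have mE : measurable (enlargement (t + eps) B : set (borel V)).
  by apply: sub_sigma_algebra; exact: open_enlargement.
have BE : B `<=` enlargement (t + eps) B.
  by move=> x Bx; exists x => //; rewrite subrr normr0.
have H (m1 m2 : probability (borel V) R) : tv_dist m1 m2 = t%:E ->
    m1 B <= m2 (enlargement (t + eps) B) + (t + eps)%:E.
  move=> m12; apply: le_trans (measure_le_tv m1 m2 mB) _; rewrite m12.
  apply: leeD; last by rewrite lee_fin lerDl ltW.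
  by apply: le_measure; rewrite ?inE.
by split; apply: H => //; rewrite tv_distC.
Qed.

Section density.
Context (la : {measure set (borel V) -> \bar R}) (f g : borel V -> R).
Variables (mu nu : probability (borel V) R).
Hypotheses (df : is_density la f mu) (dg : is_density la g nu).

Lemma is_density_integral h m : is_density la h m -> \int[la]_x (h x)%:E = 1.
Proof. by move=> [_ _ hE]; rewrite -hE// probability_setT. Qed.

Lemma is_density_integrable h m : is_density la h m ->
  la.-integrable [set: borel V] (EFin \o h).
Proof.
move=> dh; have [mh h0 _] := dh; apply/integrableP; split.
  exact/measurable_EFinP.
under eq_integral do rewrite /= ger0_norm//.
by rewrite (is_density_integral dh) ltry.
Qed.

Lemma tv_dist_le_L1 : tv_dist mu nu <= \int[la]_x `|f x - g x|%:E.
Proof.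
have [mf f0 fE] := df; have [mg g0 gE] := dg.
have fint := is_density_integrable df; have gint := is_density_integrable dg.
have mfg : measurable_fun [set: borel V] (fun x => (f x - g x)%:E).
  by apply/measurable_EFinP; exact: measurable_funB.
apply: ge_ereal_sup => _ [B mB <-].
rewrite fE// gE//.
rewrite -integralB//; last 2 first.
- exact: (integrableS measurableT).
- exact: (integrableS measurableT).
apply: (@le_trans _ _ (\int[la]_(x in B) `|f x - g x|%:E)).
  apply: le_abse_integral => //; exact: measurable_funTS.
apply: ge0_subset_integral => //.
apply/measurable_EFinP; apply: measurableT_comp => //.
exact: measurable_funB.
Qed.

Lemma L1_le_tv_dist :
  \int[la]_x `|f x - g x|%:E <= tv_dist mu nu + tv_dist mu nu.
Proof.
have [mf f0 fE] := df; have [mg g0 gE] := dg.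
have fint := is_density_integrable df; have gint := is_density_integrable dg.
have mfg : measurable_fun [set: borel V] (fun x => (f x - g x)%R).
  exact: measurable_funB.
(* on A the density f dominates g, and off A it is the other way round *)
pose A : set (borel V) := (fun x => f x - g x)%R @^-1` `[0%R, +oo[%classic.
have mA : measurable A by rewrite -[A]setTI; exact: mfg.
have mN : measurable_fun [set: borel V] (fun x => `|f x - g x|%:E).
  by apply/measurable_EFinP; exact: measurableT_comp.
have AE x : A x = (g x <= f x)%R :> Prop.
  by rewrite /A/= in_itv/= andbT subr_ge0.
have mCA : measurable (~` A) by exact: measurableC.
have mNU : measurable_fun (A `|` ~` A) (fun x => `|f x - g x|%:E).
  by rewrite setUv.
have disj : [disjoint A & ~` A] by rewrite disj_set2E setICr.
rewrite -(setUv A) ge0_integral_setU//.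
have part (k1 k2 : borel V -> R) m1 m2 (B : set (borel V)) : measurable B ->
    is_density la k1 m1 -> is_density la k2 m2 ->
    (forall x, B x -> k2 x <= k1 x)%R ->
    \int[la]_(x in B) `|k1 x - k2 x|%:E <= tv_dist m1 m2.
  move=> mB d1 d2 k21; have [_ _ k1E] := d1; have [_ _ k2E] := d2.
  have i1 := is_density_integrable d1; have i2 := is_density_integrable d2.
  apply: le_trans (tv_dist_ge m1 m2 mB); apply: le_trans (lee_abs _).
  rewrite k1E// k2E// -integralB//; last 2 first.
  - exact: (integrableS measurableT).
  - exact: (integrableS measurableT).
  rewrite le_eqVlt; apply/orP; left; apply/eqP.
  apply: eq_integral => x /set_mem Bx.
  by rewrite ger0_norm ?EFinB// subr_ge0 k21.
apply: leeD.
  by apply: part => // x; rewrite AE.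
under eq_integral do rewrite distrC.
rewrite tv_distC; apply: part => //.
by move=> x /=; rewrite AE => /negP; rewrite -ltNge => /ltW.
Qed.

End density.

(** The pair of densities given only shows that the distance is defined; the
    upper bound holds for the densities with respect to any dominating measure,
    from (sqrt a - sqrt b) ^+ 2 <= |a - b|. *)
Lemma hellinger_dist_le (la : {sigma_finite_measure set (borel V) -> \bar R})
    (f g : borel V -> R) mu nu :
  is_density la f mu -> is_density la g nu ->
  0 <= hellinger_dist mu nu <= poweR (tv_dist mu nu) 2^-1.
Proof.
move=> df dg; rewrite /hellinger_dist.
have [la' [f' [g' [df' dg' ->]]]] := xgetPex +oo (ex_intro
  [set t | exists (la : {sigma_finite_measure set (borel V) -> \bar R})
    (f g : borel V -> R), [/\ is_density la f mu, is_density la g nu &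
      t = poweR ((2^-1)%:E *
        \int[la]_x ((Num.sqrt (f x) - Num.sqrt (g x)) ^+ 2)%:E) 2^-1]] _
  (ex_intro _ la (ex_intro _ f (ex_intro _ g (And3 df dg erefl))))).
rewrite poweR_ge0/=.
have [mf f0 fE] := df'; have [mg g0 gE] := dg'.
have msqrt (h : borel V -> R) : measurable_fun [set: borel V] h ->
    measurable_fun [set: borel V] (fun x => Num.sqrt (h x)).
  move=> mh; apply: measurableT_comp mh.
  exact: (continuous_measurable_fun (@sqrt_continuous R)).
have I0 : 0 <= \int[la']_x ((Num.sqrt (f' x) - Num.sqrt (g' x)) ^+ 2)%:E.
  by apply: integral_ge0 => x _; rewrite lee_fin sqr_ge0.
apply: gt0_ler_poweR.
- by rewrite invr_ge0.
- by rewrite in_itv/= leey mule_ge0.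
- by rewrite in_itv/= leey tv_dist_ge0.
have sqrt_le (a b : R) : (0 <= a)%R -> (0 <= b)%R ->
    ((Num.sqrt a - Num.sqrt b) ^+ 2 <= `|a - b|)%R.
  move=> a0 b0; rewrite -[in leRHS](sqr_sqrtr a0) -[in leRHS](sqr_sqrtr b0).
  have := sqrtr_ge0 a; have := sqrtr_ge0 b.
  move: (Num.sqrt a) (Num.sqrt b) => x y y0 x0.
  rewrite subr_sqr normrM (ger0_norm (addr_ge0 x0 y0)).
  by have [xy|xy] := lerP y x; nra.
apply: (@le_trans _ _ ((2^-1)%:E * (tv_dist mu nu + tv_dist mu nu))).
  apply: lee_wpmul2l; first by rewrite lee_fin invr_ge0.
  apply: le_trans (L1_le_tv_dist df' dg').
  apply: ge0_le_integral => //.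
  - by move=> x _; rewrite lee_fin sqr_ge0.
  - apply/measurable_EFinP; apply: measurable_funX.
    exact: measurable_funB (msqrt _ mf) (msqrt _ mg).
  - apply/measurable_EFinP; apply: measurableT_comp => //.
    exact: measurable_funB.
  - by move=> x _; rewrite lee_fin sqrt_le.
case E : (tv_dist mu nu) (tv_dist_ge0 mu nu) => [t| |] // t0.
  by rewrite -EFinD -EFinM lee_fin; lra.
by rewrite leey.
Qed.

End DistanceComparison.

(** * A coupling of measures with densities *)

Section ProbabilityOfMeasure.
Context d (T : measurableType d) (R : realType).
Local Open Scope ereal_scope.

Lemma probability_of_measure (m : {measure set T -> \bar R}) : m setT = 1 ->
  exists P : probability T R, forall A, measurable A -> P A = m A.
Proof.
move=> m1.
have intm1 A : measurable A -> \int[m]_(x in A) 1%:E = m A.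
  by move=> mA; rewrite integral_cst// mul1e.
have one1 : \int[m]_x (cst 1%R x : R)%:E = 1 by rewrite intm1.
have onefin : \int[m]_x (cst 1%R x : R)%:E < +oo by rewrite one1 ltry.
exists (pdensity (measurable_cst (1%R : R)) (fun=> ler01) onefin one1) => A mA.
exact: intm1.
Qed.

End ProbabilityOfMeasure.

Section WassersteinBound.
Context (R : realType) (V : hilbertType R).
Local Open Scope ereal_scope.

Lemma wasserstein_dist_ge0 (p : R) (mu nu : probability (borel V) R) :
  0 <= wasserstein_dist p mu nu.
Proof. exact: poweR_ge0. Qed.

Lemma distance_powR_le (p : R) (x y : V) : (0 <= p)%R ->
  (`|x - y| `^ p <= 2 `^ p * (`|x| `^ p + `|y| `^ p))%R.
Proof.
move=> p0; pose M : R := Num.max `|x|%R `|y|%R.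
have M0 : (0 <= M)%R by rewrite le_max normr_ge0.
have xyM : (`|x - y| <= 2 * M)%R.
  rewrite (le_trans (ler_normB _ _))// mulr2n mulrDl mul1r.
  by rewrite lerD// le_max lexx ?orbT.
apply: (@le_trans _ _ ((2 * M) `^ p)%R).
  by apply: ge0_ler_powR; rewrite ?nnegrE ?mulr_ge0.
rewrite powRM// ler_wpM2l ?powR_ge0// /M.
by rewrite /Num.max; case: ifP => _; rewrite ?lerDl ?lerDr powR_ge0.
Qed.

Section coupling.
Context (la : {measure set (borel V) -> \bar R}) (f g : borel V -> R).
Variables (mu nu : probability (borel V) R).
Hypotheses (df : is_density la f mu) (dg : is_density la g nu).
Variables (e : nat -> V) (p : R).
Hypotheses (oe : orthonormal_seq e) (p0 : (0 < p)%R).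

Let m (x : borel V) : R := Num.min (f x) (g x).
Let r1 (x : borel V) : R := (f x - m x)%R.
Let r2 (x : borel V) : R := (g x - m x)%R.

Let mf : measurable_fun [set: borel V] f. Proof. by case: df. Qed.
Let mg : measurable_fun [set: borel V] g. Proof. by case: dg. Qed.
Let f0 x : (0 <= f x)%R. Proof. by case: df. Qed.
Let g0 x : (0 <= g x)%R. Proof. by case: dg. Qed.
Let mm : measurable_fun [set: borel V] m. Proof. exact: measurable_minr. Qed.
Let mr1 : measurable_fun [set: borel V] r1. Proof. exact: measurable_funB. Qed.
Let mr2 : measurable_fun [set: borel V] r2. Proof. exact: measurable_funB. Qed.
Let m0 x : (0 <= m x)%R. Proof. by rewrite le_min f0 g0. Qed.
Let r10 x : (0 <= r1 x)%R. Proof. by rewrite subr_ge0 ge_min lexx. Qed.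
Let r20 x : (0 <= r2 x)%R. Proof. by rewrite subr_ge0 ge_min lexx orbT. Qed.

Let fE A : measurable A ->
  mu A = \int[la]_(x in A) (m x)%:E + \int[la]_(x in A) (r1 x)%:E.
Proof.
move=> mA; have [_ _ ->//] := df; rewrite -ge0_integralD//.
- by apply: eq_integral => x _; rewrite -EFinD /r1 subrKC.
- by move=> x _; rewrite lee_fin.
- by apply/measurable_EFinP; exact: measurable_funTS.
- by move=> x _; rewrite lee_fin.
- by apply/measurable_EFinP; exact: measurable_funTS.
Qed.

Let gE A : measurable A ->
  nu A = \int[la]_(x in A) (m x)%:E + \int[la]_(x in A) (r2 x)%:E.
Proof.
move=> mA; have [_ _ ->//] := dg; rewrite -ge0_integralD//.
- by apply: eq_integral => x _; rewrite -EFinD /r2 subrKC.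
- by move=> x _; rewrite lee_fin.
- by apply/measurable_EFinP; exact: measurable_funTS.
- by move=> x _; rewrite lee_fin.
- by apply/measurable_EFinP; exact: measurable_funTS.
Qed.

Let I_ge0 (h : borel V -> R) A : (forall x, (0 <= h x)%R) ->
  0 <= \int[la]_(x in A) (h x)%:E.
Proof. by move=> h0; apply: integral_ge0 => x _; rewrite lee_fin. Qed.

Let mfin : \int[la]_x (m x)%:E < +oo.
Proof.
apply: (@le_lt_trans _ _ 1); last exact: ltry.
by rewrite -(probability_setT mu) fE// leeDl// I_ge0.
Qed.

Let r1fin : \int[la]_x (r1 x)%:E < +oo.
Proof.
apply: (@le_lt_trans _ _ 1); last exact: ltry.
by rewrite -(probability_setT mu) fE// leeDr// I_ge0.
Qed.

Let r2fin : \int[la]_x (r2 x)%:E < +oo.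
Proof.
apply: (@le_lt_trans _ _ 1); last exact: ltry.
by rewrite -(probability_setT nu) gE// leeDr// I_ge0.
Qed.

Let tau : R := fine (\int[la]_x (r1 x)%:E).

Let tau0 : (0 <= tau)%R. Proof. by rewrite fine_ge0// I_ge0. Qed.

Let r1T : \int[la]_x (r1 x)%:E = tau%:E.
Proof. by rewrite fineK// ge0_fin_numE// I_ge0. Qed.

Let r2T : \int[la]_x (r2 x)%:E = tau%:E.
Proof.
have Ifin : \int[la]_x (m x)%:E \is a fin_num by rewrite ge0_fin_numE// I_ge0.
have : \int[la]_x (m x)%:E + \int[la]_x (r2 x)%:E =
       \int[la]_x (m x)%:E + tau%:E.
  by rewrite -gE// -r1T -fE// !probability_setT.
rewrite addeC [RHS]addeC => h.
by rewrite -[LHS](@addeK _ _ _ Ifin) h addeK.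
Qed.

Let M0 : {finite_measure set (borel V) -> \bar R} := mdensity mm m0 mfin.
Let M1 : {finite_measure set (borel V) -> \bar R} := mdensity mr1 r10 r1fin.
Let M2 : {finite_measure set (borel V) -> \bar R} := mdensity mr2 r20 r2fin.
Let diag (x : borel V) : borel V * borel V := (x, x).

Let mdiag : measurable_fun [set: borel V] diag.
Proof. exact: measurable_fun_pair. Qed.

Let tauV0 : (0 <= tau^-1)%R. Proof. by rewrite invr_ge0. Qed.

Let D0 : {measure set (borel V * borel V) -> \bar R} :=
  measure_function_pushforward__canonical__measure_function_Measure M0 mdiag.

(** The common part m of the two densities stays on the diagonal; the
    remainders r1 and r2, of equal mass tau, are coupled independently. When
    tau is 0 both remainders vanish almost everywhere, and tau^-1 is 0. *)
Let coupling : {measure set (borel V * borel V) -> \bar R} :=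
  measure_add D0 (mscale (NngNum tauV0) (M1 \x M2)).

Let couplingE A :
  coupling A = M0 (diag @^-1` A) + (tau^-1)%:E * (M1 \x M2) A.
Proof. exact: measure_addE. Qed.

Let rescale (x : \bar R) : 0 <= x -> x <= tau%:E ->
  (tau^-1)%:E * (x * tau%:E) = x.
Proof.
move=> x0 xtau; have [t0|t0] := eqVneq tau 0%R.
  rewrite t0 invr0 mul0e; apply/eqP; rewrite eq_le x0/=.
  by move: xtau; rewrite t0.
by rewrite muleC -muleA -EFinM divff// mule1.
Qed.

Let coupling_marginals (B : set (borel V)) : measurable B ->
  coupling (B `*` setT) = mu B /\ coupling (setT `*` B) = nu B.
Proof.
move=> mB; have le1 (h : borel V -> R) : measurable_fun [set: borel V] h ->
    (forall x, (0 <= h x)%R) ->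
    \int[la]_(x in B) (h x)%:E <= \int[la]_x (h x)%:E.
  move=> mh h0; apply: ge0_subset_integral => //.
    exact/measurable_EFinP.
  by move=> x _; rewrite lee_fin.
split; rewrite couplingE.
- rewrite product_measure1E// [X in _ * (_ * X)](_ : _ = tau%:E);
    last exact: r2T.
  rewrite rescale ?I_ge0//; last first.
    by rewrite -r1T; exact: le1.
  rewrite fE//; congr (_ + _).
  by congr (M0 _); apply/seteqP; split => x //= [].
- rewrite product_measure1E// [X in _ * (X * _)](_ : _ = tau%:E);
    last exact: r1T.
  rewrite [tau%:E * _]muleC rescale ?I_ge0//; last first.
    by rewrite -r2T; exact: le1.
  rewrite gE//; congr (_ + _).
  by congr (M0 _); apply/seteqP; split => x //= [].
Qed.

Let nrm (x : borel V) : \bar R := (`|x : V| `^ p)%:E.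

Let mnrm : measurable_fun [set: borel V] nrm.
Proof. by apply/measurable_EFinP; exact: measurable_norm_powR. Qed.

Let nrm0 x : 0 <= nrm x. Proof. by rewrite lee_fin powR_ge0. Qed.

Let mcost : measurable_fun [set: borel V * borel V]
  (fun z => (`|(z.1 : V) - (z.2 : V)|%R `^ p)%:E).
Proof.
apply/measurable_EFinP.
exact: (measurableT_comp (@measurable_powR R p) (measurable_dist oe)).
Qed.

Let product_cost :
  \int[M1 \x M2]_z (nrm z.1 + nrm z.2) =
  \int[la]_x (nrm x * (r1 x)%:E) * tau%:E +
  \int[la]_x (nrm x * (r2 x)%:E) * tau%:E.
Proof.
have mn1 : measurable_fun [set: borel V * borel V] (fun z => nrm z.1).
  exact: (measurableT_comp mnrm measurable_fst).
have mn2 : measurable_fun [set: borel V * borel V] (fun z => nrm z.2).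
  exact: (measurableT_comp mnrm measurable_snd).
rewrite ge0_integralD//; congr (_ + _).
- rewrite fubini_tonelli1//= /fubini_F/=.
  under eq_integral do
    rewrite integral_cst// [X in _ * X](_ : _ = tau%:E) ?[LHS]r2T//.
  rewrite ge0_integralZr//; congr (_ * _).
  exact: ge0_integral_density.
- rewrite fubini_tonelli2//= /fubini_G/=.
  under eq_integral do
    rewrite integral_cst// [X in _ * X](_ : _ = tau%:E) ?[LHS]r1T//.
  rewrite ge0_integralZr//; congr (_ * _).
  exact: ge0_integral_density.
Qed.

Let coupling_cost :
  \int[coupling]_z (`|(z.1 : V) - (z.2 : V)|%R `^ p)%:E <=
  (2 `^ p)%:E * \int[la]_x (`|x : V| `^ p * `|f x - g x|)%:E.
Proof.
have cost0 (z : borel V * borel V) :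
    0 <= (`|(z.1 : V) - (z.2 : V)|%R `^ p)%:E by rewrite lee_fin powR_ge0.
rewrite ge0_integral_measure_add//.
have -> : \int[D0]_z (`|(z.1 : V) - (z.2 : V)|%R `^ p)%:E = 0.
  transitivity
    (\int[pushforward M0 diag]_z (`|(z.1 : V) - (z.2 : V)|%R `^ p)%:E) => //.
  rewrite ge0_integral_pushforward//; apply: integral0_eq => x _ /=.
  by rewrite subrr normr0 powR0// gt_eqF.
rewrite add0e ge0_integral_mscale//=.
have K0 : 0 <= (2 `^ p)%:E :> \bar R by rewrite lee_fin powR_ge0.
have A0 (h : borel V -> R) : (forall x, (0 <= h x)%R) ->
    0 <= \int[la]_x (nrm x * (h x)%:E).
  by move=> h0; apply: integral_ge0 => x _; rewrite mule_ge0// lee_fin.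
have mnh (h : borel V -> R) : measurable_fun [set: borel V] h ->
    measurable_fun [set: borel V] (fun x => nrm x * (h x)%:E).
  by move=> mh; apply: emeasurable_funM => //; exact/measurable_EFinP.
have -> : \int[la]_x (`|x : V| `^ p * `|f x - g x|)%:E =
    \int[la]_x (nrm x * (r1 x)%:E) + \int[la]_x (nrm x * (r2 x)%:E).
  rewrite -ge0_integralD//; last 4 first.
  - by move=> x _; rewrite mule_ge0// lee_fin.
  - exact: mnh.
  - by move=> x _; rewrite mule_ge0// lee_fin.
  - exact: mnh.
  apply: eq_integral => x _; rewrite -!EFinM -EFinD -mulrDr; congr (_ * _)%:E.
  rewrite /r1 /r2 /m; have [fg|fg] := leP (f x) (g x).
    by rewrite subrr add0r distrC ger0_norm// subr_ge0.
  by rewrite subrr addr0 gtr0_norm// subr_gt0.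
set X := _ + _.
apply: (@le_trans _ _ ((tau^-1)%:E * ((2 `^ p)%:E * (X * tau%:E)))).
  rewrite lee_wpmul2l ?lee_fin// /X ge0_muleDl ?A0// -product_cost.
  rewrite -ge0_integralZl//; last 2 first.
  - apply: emeasurable_funD.
      exact: (measurableT_comp mnrm measurable_fst).
    exact: (measurableT_comp mnrm measurable_snd).
  - by move=> z _; rewrite adde_ge0.
  apply: ge0_le_integral => //.
  - apply: emeasurable_funM; first exact: measurable_cst.
    apply: emeasurable_funD.
      exact: (measurableT_comp mnrm measurable_fst).
    exact: (measurableT_comp mnrm measurable_snd).
  - move=> z _; rewrite -EFinD -EFinM lee_fin.
    by apply: distance_powR_le; exact: ltW.
have X0 : 0 <= X by rewrite adde_ge0 ?A0.
have [t0|t0] := eqVneq tau 0%R.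
  by rewrite t0 invr0 mul0e mule_ge0.
by rewrite muleCA [X * _]muleC [(tau^-1)%:E * _]muleA -EFinM mulVf// mul1e.
Qed.

(** The cost of this coupling is at most a weighted L1 distance of the
    densities. *)
Lemma wasserstein_dist_le :
  wasserstein_dist p mu nu <=
  poweR ((2 `^ p)%:E * \int[la]_x (`|x : V| `^ p * `|f x - g x|)%:E) p^-1.
Proof.
have cT : coupling setT = 1.
  by rewrite -setXTT (coupling_marginals measurableT).1 probability_setT.
have [pi piE] := probability_of_measure cT.
have I0 : 0 <= \int[la]_x (`|x : V| `^ p * `|f x - g x|)%:E.
  by apply: integral_ge0 => x _; rewrite lee_fin mulr_ge0// powR_ge0.
rewrite /wasserstein_dist; set I := ereal_inf _.
have Ige0 : 0 <= I.
  apply: le_ereal_inf_tmp => _ [q _ <-]; apply: integral_ge0 => z _.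
  by rewrite lee_fin powR_ge0.
apply: gt0_ler_poweR.
- by rewrite invr_ge0 ltW.
- by rewrite in_itv/= leey Ige0.
- by rewrite in_itv/= leey mule_ge0// lee_fin powR_ge0.
apply: le_trans coupling_cost; apply: ereal_inf_lbound; exists pi.
  move=> B mB; rewrite !piE; [exact: coupling_marginals|..];
  exact: measurableX.
by apply: eq_measure_integral => A mA _; exact: piE.
Qed.

End coupling.
End WassersteinBound.

(** * The posterior measure *)

Section Posterior.
Context (R : realType) (V : hilbertType R) (Y : normedModType R).
Variables (prior : probability (borel V) R) (L : Y -> V -> R) (M : R).
Hypothesis mL : forall d, measurable_fun [set: borel V] (L d : borel V -> R).
Hypothesis L_gt0 : forall u d, 0 < L d u.
Hypothesis L_le : forall u d, L d u <= M.
Hypothesis cL : forall u, continuous (L^~ u).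
Local Open Scope ereal_scope.

Let mEL d : measurable_fun [set: borel V] (fun u : borel V => (L d u)%:E).
Proof. by apply/measurable_EFinP; exact: mL. Qed.

Let prior_cst (c : R) : \int[prior]_u c%:E = c%:E.
Proof.
by rewrite integral_cst// [X in _ * X](probability_setT prior) mule1.
Qed.

Lemma evidence_le d : evidence prior L d <= M%:E.
Proof.
rewrite -prior_cst; apply: ge0_le_integral => //.
- by move=> u _; rewrite lee_fin ltW.
- by move=> u _; rewrite lee_fin.
Qed.

Lemma evidence_gt0 d : 0 < evidence prior L d.
Proof.
rewrite lt_neqAle integral_ge0 ?andbT; last by move=> u _; rewrite lee_fin ltW.
apply/eqP => Z0.
have : \int[prior]_u `|(L d u)%:E| = 0.
  rewrite [RHS]Z0; apply: eq_integral => u _.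
  by rewrite gee0_abs// lee_fin ltW.
move/(ae_eq_integral_abs _ measurableT (mEL d)) => [N [mN N0 sN]].
have NT : N = setT.
  apply/seteqP; split => // u _; apply: sN => /= /(_ I)[Lu0].
  by have := L_gt0 u d; rewrite Lu0 ltxx.
have := probability_setT prior; rewrite -NT N0.
by move/eqP; rewrite eq_sym onee_eq0.
Qed.

Let Z d : R := fine (evidence prior L d).

Let evidence_fin d : evidence prior L d < +oo.
Proof. by apply: le_lt_trans (evidence_le d) _; rewrite ltry. Qed.

Let ZE d : evidence prior L d = (Z d)%:E.
Proof. by rewrite fineK// ge0_fin_numE ?evidence_fin// ltW// evidence_gt0. Qed.

Let Z_gt0 d : (0 < Z d)%R.
Proof. by rewrite -lte_fin -ZE evidence_gt0. Qed.

Let Z_cvg d : Z d' @[d' --> d] --> Z d.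
Proof.
have h : \int[prior]_u (L d' u)%:E @[d' --> d] --> \int[prior]_u (L d u)%:E.
  apply: (@dominated_cvg_param R Y _ (borel V) prior L d (cst M)) => //.
  - by move=> u; exact: cL.
  - by apply: nearW => d' u; rewrite gtr0_norm.
  - by rewrite prior_cst ltry.
have : \int[prior]_u (L d' u)%:E @[d' --> d] --> (Z d)%:E by rewrite -ZE.
by move=> /fine_cvgP[].
Qed.

(** The density of the posterior with respect to the prior, given by Bayes'
    formula. *)
Definition posterior_density (d : Y) (u : borel V) : R := ((Z d)^-1 * L d u)%R.

Let f := posterior_density.

Let mf d : measurable_fun [set: borel V] (f d).
Proof. exact: measurable_funM (measurable_cst _) (mL d). Qed.

Let f_ge0 d u : (0 <= f d u)%R.
Proof. by rewrite mulr_ge0// ?invr_ge0 ltW. Qed.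

Let f_int d : \int[prior]_u (f d u)%:E = 1.
Proof.
under eq_integral do rewrite EFinM.
rewrite ge0_integralZl//; last 2 first.
- by move=> u _; rewrite lee_fin ltW.
- by rewrite lee_fin invr_ge0 ltW.
by rewrite [X in _ * X]ZE -EFinM mulVf// gt_eqF.
Qed.

Let f_fin d : \int[prior]_u (f d u)%:E < +oo.
Proof. by rewrite f_int ltry. Qed.

(** The posterior measure. *)
Definition posterior (d : Y) : probability (borel V) R :=
  pdensity (mf d) (f_ge0 d) (f_fin d) (f_int d).

Lemma posteriorP d : is_posterior prior L d (posterior d).
Proof. by split=> //; rewrite evidence_gt0 evidence_fin. Qed.

Lemma posterior_is_density d : is_density prior (f d) (posterior d).
Proof. by split. Qed.

Lemma posterior_unique d (nu : probability (borel V) R) :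
  is_posterior prior L d nu ->
  forall B : set (borel V), measurable B -> nu B = posterior d B.
Proof. by move=> [_ nuE] B mB; rewrite nuE. Qed.

Section weighted.
Variable phi : borel V -> R.
Hypotheses (mphi : measurable_fun [set: borel V] phi)
  (phi0 : forall u, (0 <= phi u)%R) (phifin : \int[prior]_u (phi u)%:E < +oo).

Let cphi_fin (c : R) : (0 <= c)%R -> \int[prior]_u (phi u * c)%:E < +oo.
Proof.
move=> c0; under eq_integral do rewrite EFinM.
rewrite ge0_integralZr//.
- by rewrite muleC lte_mul_pinfty// lee_fin.
- exact/measurable_EFinP.
- by move=> u _; rewrite lee_fin.
Qed.

(** Stability of the posterior densities in L1 with any prior-integrable weight.
    Near d the evidence exceeds half its value at d, so that the densities are
    bounded by c = 2 * M / Z d. *)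
Lemma posterior_density_cvg d :
  \int[prior]_u (phi u * `|f d' u - f d u|)%:E @[d' --> d] --> 0.
Proof.
pose g d' (u : borel V) : R := (phi u * `|f d' u - f d u|)%R.
have mg d' : measurable_fun [set: borel V] (g d').
  apply: measurable_funM => //; apply: measurableT_comp => //.
  exact: measurable_funB.
have -> : 0 = \int[prior]_u (g d u)%:E.
  by rewrite integral0_eq// => u _; rewrite /g subrr normr0 mulr0.
have M_ge0 : (0 <= M)%R by apply: le_trans (L_le 0%R d); exact: ltW.
pose c : R := (2 * M / Z d)%R.
have c0 : (0 <= c)%R by rewrite divr_ge0 ?mulr_ge0// ltW.
apply: (@dominated_cvg_param R Y _ (borel V) prior g d
  (fun u => phi u * c)%R) => //.
- move=> u; rewrite [X in _ --> X]/g; apply: cvgM; first exact: cvg_cst.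
  apply: cvg_norm; apply: cvgB; last exact: cvg_cst.
  apply: cvgM; last exact: cL.
  by apply: cvgV; [rewrite gt_eqF|exact: Z_cvg].
- have Z2 : \forall d' \near d, (Z d / 2 < Z d')%R.
    apply: (cvgr_gt _ (@Z_cvg d)).
    by rewrite ltr_pdivrMr// mulr2n mulrDr mulr1 ltrDl.
  near=> d' => u.
  have Zd' : (Z d / 2 < Z d')%R by near: d'.
  have f1 : (f d' u <= c)%R.
    rewrite /f /posterior_density /c ler_pdivrMl//.
    apply: le_trans (L_le _ _) _.
    rewrite mulrA ler_pdivlMr//; have := Z_gt0 d; nra.
  have f2 : (f d u <= c)%R.
    rewrite /f /posterior_density /c ler_pdivrMl// mulrCA mulfV ?gt_eqF// mulr1.
    by apply: le_trans (L_le _ _) _; lra.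
  rewrite /g normrM ger0_norm// normr_id ler_wpM2l//.
  by rewrite ler_norml; have := f_ge0 d u; have := f_ge0 d' u; lra.
- exact: measurable_funM mphi (measurable_cst _).
- exact: cphi_fin.
Unshelve. all: by end_near. Qed.

Lemma posterior_integral_fin d : \int[posterior d]_u (phi u)%:E < +oo.
Proof.
have mEphi : measurable_fun [set: borel V] (fun u => (phi u)%:E).
  exact/measurable_EFinP.
rewrite (@ge0_integral_density _ _ _ prior (posterior d) (f d) _ (@mf d)
  (f_ge0 d) (fun _ _ => erefl) mEphi)//.
have c0 : (0 <= (Z d)^-1 * M)%R.
  by rewrite mulr_ge0 ?invr_ge0 ?ltW//; apply: lt_le_trans (L_le 0%R d).
apply: le_lt_trans (cphi_fin c0); apply: ge0_le_integral => //.
- by move=> u _; rewrite -EFinM lee_fin mulr_ge0.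
- by apply: emeasurable_funM; exact/measurable_EFinP.
- by apply/measurable_EFinP; exact: measurable_funM mphi (measurable_cst _).
- move=> u _; rewrite -EFinM lee_fin ler_wpM2l// ler_wpM2l// invr_ge0 ltW//.
Qed.

End weighted.

End Posterior.

(** * Stability and well-posedness *)

Lemma poweR_cvg0 (R : realType) (T : Type) (F : set_system T) (FF : Filter F)
    (h : T -> \bar R) (r : R) : 0 < r -> (forall t, 0 <= h t)%E ->
  h @ F --> 0%E -> poweR (h t) r @[t --> F] --> 0%E.
Proof.
move=> r0 h0 /fine_cvgP[hfin hcvg]; apply/fine_cvgP; split.
  by apply: filterS hfin => t; case: (h t).
apply/cvgr0Pnorm_lt => eps eps0.
have d0 : 0 < eps `^ r^-1 by exact: powR_gt0.
have hd : \forall t \near F, `|fine (h t)| < eps `^ r^-1.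
  by move/cvgr0Pnorm_lt : hcvg; exact.
apply: filterS2 hfin hd => t; rewrite /=; have := h0 t.
case: (h t) => //= x x0 _.
have {}x0 : 0 <= x := x0.
rewrite ger0_norm// ger0_norm ?powR_ge0// => xd.
have -> : eps = (eps `^ r^-1) `^ r.
  by rewrite -powRrM mulVf ?gt_eqF// powRr1// ltW.
by apply: gt0_ltr_powR; rewrite ?nnegrE ?powR_ge0.
Qed.

Section WellPosedness.
Context (R : realType) (V : hilbertType R) (Y : normedModType R).
Variables (prior : probability (borel V) R) (L : Y -> V -> R) (M : R).
Hypothesis mL : forall d, measurable_fun [set: borel V] (L d : borel V -> R).
Hypothesis L_gt0 : forall u d, 0 < L d u.
Hypothesis L_le : forall u d, L d u <= M.
Hypothesis cL : forall u, continuous (L^~ u).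
Local Open Scope ereal_scope.

Let post := posterior prior mL L_gt0 L_le.
Let f := posterior_density prior L.

Let is_dens d : is_density prior (f d) (post d).
Proof. exact: posterior_is_density. Qed.

Lemma posterior_tv_cvg d : tv_dist (post d') (post d) @[d' --> d] --> 0.
Proof.
have h : \int[prior]_u (cst 1%R u * `|f d' u - f d u|)%:E @[d' --> d] --> 0.
  apply: (@posterior_density_cvg R V Y prior L M mL L_gt0 L_le cL
    (cst 1%R)) => //.
  suff : \int[prior]_u (1%:E : \bar R) < +oo by [].
  by rewrite integral_cst// [X in _ * X](probability_setT prior) mule1 ltry.
apply: squeeze_cvge (cvg_cst 0) h; apply: nearW => d'.
rewrite tv_dist_ge0/=.
apply: le_trans (tv_dist_le_L1 (is_dens d') (is_dens d)) _.
by under [leRHS]eq_integral do rewrite mul1r.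
Qed.

Lemma posterior_prokhorov_cvg d :
  prokhorov_dist (post d') (post d) @[d' --> d] --> 0.
Proof.
apply: squeeze_cvge (cvg_cst 0) (@posterior_tv_cvg d); apply: nearW => d'.
by rewrite prokhorov_dist_ge0 prokhorov_le_tv.
Qed.

Lemma posterior_hellinger_cvg d :
  hellinger_dist (post d') (post d) @[d' --> d] --> 0.
Proof.
have h : poweR (tv_dist (post d') (post d)) 2^-1 @[d' --> d] --> 0.
  apply: poweR_cvg0 (@posterior_tv_cvg d); first by rewrite invr_gt0.
  by move=> d'; exact: tv_dist_ge0.
apply: squeeze_cvge (cvg_cst 0) h; apply: nearW => d'.
exact: hellinger_dist_le (is_dens d') (is_dens d).
Qed.

Lemma posterior_wasserstein_cvg (e : nat -> V) (p : R) d :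
  orthonormal_seq e -> (0 < p)%R ->
  \int[prior]_u (`|u : V| `^ p)%:E < +oo ->
  wasserstein_dist p (post d') (post d) @[d' --> d] --> 0.
Proof.
move=> oe p0 mom.
have h : \int[prior]_u (`|u : V| `^ p * `|f d' u - f d u|)%:E @[d' --> d] --> 0.
  apply: (@posterior_density_cvg R V Y prior L M mL L_gt0 L_le cL
    (fun u : borel V => `|u : V| `^ p)%R) => //.
  exact: measurable_norm_powR.
have h2 : poweR ((2 `^ p)%:E *
    \int[prior]_u (`|u : V| `^ p * `|f d' u - f d u|)%:E) p^-1
    @[d' --> d] --> 0.
  apply: poweR_cvg0.
  - by rewrite invr_gt0.
  - move=> d'; rewrite mule_ge0 ?lee_fin ?powR_ge0//.
    by apply: integral_ge0 => u _; rewrite lee_fin mulr_ge0// powR_ge0.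
  - by rewrite -[X in _ --> X](mule0 (2 `^ p)%:E); exact: cvgeZl.
apply: squeeze_cvge (cvg_cst 0) h2; apply: nearW => d'.
rewrite wasserstein_dist_ge0/=.
exact: (wasserstein_dist_le (is_dens d') (is_dens d) oe p0).
Qed.

Lemma well_posed_posterior (PP : set (probability (borel V) R)) rho :
  (forall d, PP (post d)) ->
  (forall d, rho (post d') (post d) @[d' --> d] --> 0) ->
  well_posed PP rho prior L.
Proof.
move=> PPpost rho0; exists post; split => // d; split => //.
- exact: posteriorP.
- by move=> nu _; exact: posterior_unique.
Qed.

(** Well-posedness for any prior with finite moments and any positive, bounded
    likelihood that is continuous in the data. The family e only serves to make
    the distance measurable on the product space. *)
Lemma bayes_well_posed (e : nat -> V) : orthonormal_seq e ->
  (forall p, (0 < p)%R -> \int[prior]_u (`|u : V| `^ p)%:E < +oo) ->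
  [/\ weakly_well_posed prior L, hellinger_well_posed prior L,
      tv_well_posed prior L
    & forall p : R, (1 <= p)%R -> wasserstein_well_posed p prior L].
Proof.
move=> oe mom; split.
- by apply: well_posed_posterior => //; exact: posterior_prokhorov_cvg.
- by apply: well_posed_posterior => //; exact: posterior_hellinger_cvg.
- by apply: well_posed_posterior => //; exact: posterior_tv_cvg.
move=> p p1; have p0 : (0 < p)%R by exact: lt_le_trans p1.
apply: well_posed_posterior => d; last first.
  exact: (@posterior_wasserstein_cvg e p d oe p0 (mom p p0)).
apply: posterior_integral_fin.
- exact: measurable_norm_powR.
- by move=> u; exact: powR_ge0.
- exact: mom.
Qed.

End WellPosedness.

Theorem theorem9 (R : realType) (Hu H : hilbertType R)
    (C0 : {linear Hu -> Hu}) (mu0 : probability (borel Hu) R)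
    (iota : {linear H -> Hu}) (T : R) (Theta : Type)
    (h : Theta -> Hu -> R -> Hu) (Nd : nat) (Phi : 'rV[R]_Nd -> Hu -> R) :
  separable Hu ->
  is_centered_gaussian C0 mu0 ->
  is_cameron_martin C0 iota ->
  0 < T ->
  (forall theta, ode_well_posed T (h theta)) ->
  (forall d, measurable_fun [set: borel Hu] (likelihood Phi d : borel Hu -> R)) ->
  (forall theta, class_T mu0 C0 iota T (h theta)) ->
  (forall u, continuous (fun d => likelihood Phi d u)) ->
  (exists M : R, forall u d, 0 < likelihood Phi d u <= M) ->
  forall theta,
    let prior : set (borel Hu) -> \bar R :=
      pushforward mu0 (flow_map T (h theta) : borel Hu -> borel Hu) in
    let L := likelihood Phi in
    [/\ weakly_well_posed prior L,
        hellinger_well_posed prior L,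
        tv_well_posed prior L
      & forall p : R, 1 <= p -> wasserstein_well_posed p prior L].
Proof.
move=> sepV gauss _ T0 wp mL hT cL [M LM] theta prior L.
have [[cC0 _ _] _ _] := gauss.
have [K [Lip hKL]] := class_T_bounds cC0 (hT theta).
have [wp0 _] := wp theta.
set f := flow_map T (h theta).
have cf : continuous f.
  by apply: (flow_map_continuous T0 wp0) => t t0T; exact: (hKL t t0T).2.
have fdist u : `|f u - u| <= K * T.
  by apply: flow_map_dist_le => // u' t t0T; exact: (hKL t t0T).1.
have mf : measurable_fun [set: borel Hu] (f : borel Hu -> borel Hu).
  exact: continuous_borel_measurable.
pose X : {mfun borel Hu >-> borel Hu} :=
  HB.pack (f : borel Hu -> borel Hu) (isMeasurableFun.Build _ _ _ _ _ mf).
pose nu : probability (borel Hu) R := distribution mu0 X.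
have [c c0 expfin] := fernique sepV gauss.
have [e [_ [oe _]]] := gaussian_trace_seq sepV gauss.
apply: (@bayes_well_posed R Hu _ nu L M mL) oe _ => //.
- by move=> u d; have /andP[] := LM u d.
- by move=> u d; have /andP[] := LM u d.
- by move=> p p0; exact: (pushforward_moment_fin cf fdist c0 expfin p0).
Qed.
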